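(* Let $H$ be a complex Hilbert space and let $A:\mathcal{D}(A)\subset H\to H$ be a closed, densely defined linear operator. For $\varepsilon>0$ and $\gamma>0$ let $$S_\gamma=\left\{s\in\varrho(A): \|(A-s)^{-1}\|=\frac{1}{\varepsilon+\gamma}\right\},\qquad \delta_s=\frac{\|(A-s)^{-1}\|^2\varepsilon}{1-\|(A-s)^{-1}\|\varepsilon}\quad (s\in S_\gamma)$$ (both depending on $\varepsilon$). Then: (a) For every $\varepsilon>0$, $$\sigma_\varepsilon(A)\subset\bigcap_{\gamma>0}\bigcap_{s\in S_\gamma}\left[\left(B_{\delta_s}(W((A-s)^{-1}))\right)^{-1}+s\right]\subset\left\{\lambda\in\mathbb{C}:\|(A-\lambda)^{-1}\|\ge\frac1\varepsilon\right\}.$$ (b) For every $\varepsilon>0$, $$\left\{\lambda\in\mathbb{C}:\|(A-\lambda)^{-1}\|\ge\frac1\varepsilon\right\}=\bigcap_{\gamma>0}\bigcap_{s\in S_\gamma}\left[\left(\overline{B_{\delta_s}(W((A-s)^{-1}))}\right)^{-1}+s\right].$$ (c) If in addition $A$ is normal with compact resolvent and $L>0$, then there exists $\varepsilon_0>0$ such that for all $0<\varepsilon<\varepsilon_0$ $$\sigma_\varepsilon(A)\cap\overline{B_L(0)}=\bigcap_{\gamma>0}\bigcap_{s\in S_\gamma}\left[\left(B_{\delta_s}(W((A-s)^{-1}))\right)^{-1}+s\right]\cap\overline{B_L(0)}.$$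
   Context: $\varrho(A)$ is the resolvent set and $\sigma(A)=\mathbb{C}\setminus\varrho(A)$ the spectrum of $A$; $\|\cdot\|$ is the operator norm on bounded operators on $H$, and $\|(A-\lambda)^{-1}\|$ is understood to be $\infty$ for $\lambda\in\sigma(A)$. For $\varepsilon>0$ the $\varepsilon$-pseudospectrum is $\sigma_\varepsilon(A)=\{\lambda\in\mathbb{C}: \|(A-\lambda)^{-1}\|>\frac1\varepsilon\}$ (so it contains $\sigma(A)$). The numerical range of an operator $T$ is $W(T)=\{\langle Tx,x\rangle: x\in\mathcal{D}(T),\ \|x\|=1\}$. For $U\subset\mathbb{C}$ and $\delta>0$: $B_\delta(U)=\{z\in\mathbb{C}:\operatorname{dist}(z,U)<\delta\}$, $U^{-1}=\{z^{-1}: z\in U\setminus\{0\}\}$, $U+s=\{z+s: z\in U\}$; $B_L(0)$ is the open disc of radius $L$ around $0$; a bar denotes closure. An intersection over an empty index set is $\mathbb{C}$. *)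

(* Defs.v *)
From HB Require Import structures.
From mathcomp Require Import all_boot all_order all_algebra.
From mathcomp Require Import complex.
From mathcomp Require Import all_classical all_reals all_analysis.

Set Implicit Arguments.
Unset Strict Implicit.
Unset Printing Implicit Defensive.
Import Order.TTheory GRing.Theory Num.Theory.
Import numFieldNormedType.Exports.
Local Open Scope classical_set_scope.
Local Open Scope ring_scope.
Local Open Scope complex_scope.

(* The norms of R[i] and of normed modules over R[i] take their values in R[i]
   (on its nonnegative real axis); [rnorm] is the same norm with values in R. *)
Definition rnorm (R : realType) (V : normedZmodType R[i]) (x : V) : R :=
  complex.Re `|x|.

Section plane_sets.
Variable R : realType.
Implicit Types (z s : R[i]) (U : set R[i]).

(* +oo when U is empty *)
Definition dist_set z U : \bar R :=
  ereal_inf [set (rnorm (z - u))%:E | u in U].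

Definition nbhd (delta : R) U : set R[i] :=
  [set z | (dist_set z U < delta%:E)%E].

Definition inv_set U : set R[i] := [set z^-1 | z in U `\ 0].

Definition shift_set U s : set R[i] := [set z + s | z in U].

(* R[i] gets its usual topology through its copy R[i]^o as a normed module. *)
Definition closure_set U : set R[i] := closure (U : set R[i]^o).

Definition disc (L : R) : set R[i] := [set z | rnorm z < L].

End plane_sets.

Section everywhere_defined.
Variables (R : realType) (H : completeNormedModType R[i]).
Implicit Type T : H -> H.

Definition opnorm T : \bar R :=
  ereal_sup [set (rnorm (T x))%:E | x in [set x | rnorm x <= 1]].

(* [{dot H for conjC}] is linear in its first argument and conjugate-linear in
   its second one. *)
Definition numerical_range (dot : {dot H for Num.conj}) T : set R[i] :=
  [set dot (T x) x | x in [set x | rnorm x = 1]].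

Definition compact_op T := precompact (T @` [set x | rnorm x <= 1]).

End everywhere_defined.

(* Possibly unbounded operators; the values of [app] outside [dom] are
   irrelevant. *)
Record linop (R : realType) (H : completeNormedModType R[i]) := LinOp {
  dom : set H;
  app :> H -> H;
  dom0 : dom 0;
  domP : forall (a : R[i]) (x y : H), dom x -> dom y -> dom (a *: x + y);
  appP : forall (a : R[i]) (x y : H), dom x -> dom y ->
    app (a *: x + y) = a *: app x + app y }.

Section unbounded.
Variables (R : realType) (H : completeNormedModType R[i]).
Variable (A : linop H).
Implicit Types (s lambda : R[i]) (eps gamma : R).

Definition graph : set (H * H) := [set p | dom A p.1 /\ p.2 = A p.1].

Definition closed_op := closed graph.

Definition densely_defined := dense (dom A).

(* (A - s)^-1 y, with the value 0 if there is no preimage *)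
Definition resolvent s (y : H) : H :=
  xget 0 [set x | dom A x /\ A x - s *: x = y].

Definition resolvent_set : set R[i] :=
  [set s | set_bij (dom A) setT (fun x => A x - s *: x) /\
           (opnorm (resolvent s) < +oo)%E].

(* +oo on the spectrum *)
Definition resolvent_norm lambda : \bar R :=
  if `[< resolvent_set lambda >] then opnorm (resolvent lambda) else +oo%E.

Definition pseudospectrum eps : set R[i] :=
  [set lambda | ((eps^-1)%:E < resolvent_norm lambda)%E].

Definition level_set eps gamma : set R[i] :=
  [set s | resolvent_set s /\ opnorm (resolvent s) = ((eps + gamma)^-1)%:E].

Definition delta eps s : R :=
  let r := fine (opnorm (resolvent s)) in r ^+ 2 * eps / (1 - r * eps).

Section inner_product.
Variable dot : {dot H for Num.conj}.

(* Graph of the adjoint: z = A* y iff <A x, y> = <x, z> for all x in dom A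
   (it is the graph of a function when A is densely defined). *)
Definition adjoint_graph : set (H * H) :=
  [set p | forall x, dom A x -> dot (A x) p.1 = dot x p.2].

(* A* A = A A*, domains included; the left set is the graph of A* A *)
Definition normal_op :=
  [set p : H * H | exists y, graph (p.1, y) /\ adjoint_graph (y, p.2)] =
  [set p : H * H | exists y, adjoint_graph (p.1, y) /\ graph (y, p.2)].

Definition enclosure eps : set R[i] :=
  \bigcap_(gamma in [set g : R | 0 < g]) \bigcap_(s in level_set eps gamma)
    shift_set (inv_set
      (nbhd (delta eps s) (numerical_range dot (resolvent s)))) s.

Definition closed_enclosure eps : set R[i] :=
  \bigcap_(gamma in [set g : R | 0 < g]) \bigcap_(s in level_set eps gamma)
    shift_set (inv_set (closure_set
      (nbhd (delta eps s) (numerical_range dot (resolvent s))))) s.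

End inner_product.

Definition compact_resolvent :=
  exists2 s, resolvent_set s & compact_op (resolvent s).

End unbounded.

(* Main.v *)
(* Put T = (A - s)^-1 and mu = (lambda - s)^-1, so that
   A - lambda = - mu^-1 (T - mu) (A - s). If |<T x, x> - mu| >= d > 0 on the unit
   sphere, then T - mu is bijective and |(A - lambda)^-1| <= |mu| |T| / d. For s in
   S_gamma, taking d = |mu| - |T| shows that |(A - lambda)^-1| >= 1/eps forces
   |lambda - s| >= gamma, and then taking d = delta_s shows that mu lies in (the
   closure of) the delta_s-neighbourhood of W(T). Conversely, a point lambda with
   |(A - lambda)^-1| < 1/eps lies itself in some S_gamma, and 0 is never an inverse.

   In (c) only the points with |(A - lambda)^-1| = 1/eps matter. The resolvents of
   a normal operator with compact resolvent are normal and compact, hence have an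
   eigenvalue of modulus equal to their norm; thus |(A - s)^-1| is the inverse
   distance from s to the eigenvalues, which are separated in bounded discs. *)
Require Import Defs.
From HB Require Import structures.
From mathcomp Require Import all_boot all_order all_algebra.
From mathcomp Require Import complex.
From mathcomp Require Import all_classical all_reals all_analysis.
From mathcomp Require Import ring lra.
Import Order.TTheory GRing.Theory Num.Theory.
Import numFieldNormedType.Exports.
Local Open Scope classical_set_scope.
Local Open Scope ring_scope.
Local Open Scope complex_scope.
Set Implicit Arguments.
Unset Strict Implicit.
Unset Printing Implicit Defensive.

Local Notation Re := complex.Re.

(** * Real-valued norms *)

Section real_norm.
Variable R : realType.

Section normed_zmod.
Variable V : normedZmodType R[i].
Implicit Types x y z : V.

Lemma rnormE x : `|x| = (rnorm x)%:C.
Proof. by rewrite /rnorm RRe_real// ger0_real. Qed.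

Lemma rnorm_ge0 x : 0 <= rnorm x.
Proof. by have := normr_ge0 x; rewrite rnormE ler0c. Qed.

Lemma rnorm0 : rnorm (0 : V) = 0.
Proof. by rewrite /rnorm normr0. Qed.

Lemma rnorm_eq0 x : (rnorm x == 0) = (x == 0).
Proof. by rewrite -(inj_eq (@complexI R)) -rnormE normr_eq0. Qed.

Lemma rnorm_gt0 x : (0 < rnorm x) = (x != 0).
Proof. by rewrite lt_def rnorm_eq0 rnorm_ge0 andbT. Qed.

Lemma rnormN x : rnorm (- x) = rnorm x.
Proof. by rewrite /rnorm normrN. Qed.

Lemma rnorm_distC x y : rnorm (x - y) = rnorm (y - x).
Proof. by rewrite /rnorm distrC. Qed.

Lemma ler_rnormD x y : rnorm (x + y) <= rnorm x + rnorm y.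
Proof. by rewrite -lecR rmorphD /= -!rnormE ler_normD. Qed.

Lemma ler_rnormB x y : rnorm (x - y) <= rnorm x + rnorm y.
Proof. by rewrite -(rnormN y); exact: ler_rnormD. Qed.

Lemma lerB_rnorm x y : rnorm x - rnorm y <= rnorm (x - y).
Proof. by rewrite lerBlDr -{1}(subrK y x) ler_rnormD. Qed.

End normed_zmod.

Lemma rnormM (a b : R[i]) : rnorm (a * b) = rnorm a * rnorm b.
Proof. by apply: (@complexI R); rewrite -rnormE normrM !rnormE rmorphM. Qed.

Lemma rnormV (a : R[i]) : rnorm a^-1 = (rnorm a)^-1.
Proof. by apply: (@complexI R); rewrite -rnormE normfV rnormE fmorphV. Qed.

Lemma rnormC (a : R) : rnorm a%:C = `|a|.
Proof. by apply: (@complexI R); rewrite -rnormE normc_def /= expr0n addr0 sqrtr_sqr. Qed.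

Lemma rnormJ (a : R[i]) : rnorm (Num.conj a) = rnorm a.
Proof. by rewrite /rnorm norm_conjC. Qed.

Lemma ler_Re_rnorm (a : R[i]) : Re a <= rnorm a.
Proof.
by rewrite -lecR -rnormE (le_trans _ (normc_ge_Re a))// lecR ler_norm.
Qed.

Lemma sqr_rnorm (a : R[i]) : ((rnorm a)%:C ^+ 2 = a * Num.conj a :> R[i]).
Proof. by rewrite -rnormE -normCK. Qed.

Lemma conj_realC (a : R) : Num.conj (a%:C : R[i]) = a%:C.
Proof. by apply/conj_Creal/complex_realP; exists a. Qed.

Lemma ReJ (a : R[i]) : Re (Num.conj a) = Re a.
Proof. by case: a. Qed.

Lemma rnormZ (V : normedModType R[i]) (a : R[i]) (x : V) :
  rnorm (a *: x) = rnorm a * rnorm x.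
Proof. by apply: (@complexI R); rewrite -rnormE normrZ !rnormE rmorphM. Qed.

Lemma ball_rnorm (V : normedModType R[i]) (x y : V) (e : R) :
  ball x e%:C y <-> rnorm (x - y) < e.
Proof. by rewrite -ball_normE /ball_ /= rnormE ltcR. Qed.

(** Positivity in [R[i]] forces a zero imaginary part, so the epsilons of the topology can be taken
    in [R]. *)
Lemma real_eps (e : R[i]) : 0 < e -> exists2 r : R, 0 < r & e = r%:C.
Proof.
move=> e0; exists (Re e); last by rewrite RRe_real// gtr0_real.
by rewrite -ltcR RRe_real// gtr0_real.
Qed.

Section convergence.
Variable H : completeNormedModType R[i].
Implicit Types (u v : nat -> H) (l : H).

Lemma rcvgP u l : u @ \oo --> l <-> rnorm (u n - l) @[n --> \oo] --> (0 : R).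
Proof.
split=> [/cvgrPdist_lt ul|/cvgrPdist_lt ul].
  apply/cvgrPdist_lt => e e0; have := ul e%:C; rewrite ltcR => /(_ e0).
  apply: filterS => n; rewrite rnormE ltcR rnorm_distC sub0r normrN.
  by rewrite ger0_norm ?rnorm_ge0.
apply/cvgrPdist_lt => _ /real_eps[e e0 ->]; have := ul e e0.
apply: filterS => n; rewrite rnormE ltcR rnorm_distC sub0r normrN.
by rewrite ger0_norm ?rnorm_ge0.
Qed.

Lemma rcauchy_cvg u :
  (forall e : R, 0 < e -> exists N, forall m n, (N <= m)%N -> (N <= n)%N ->
     rnorm (u m - u n) < e) -> exists l, u @ \oo --> l.
Proof.
move=> uC; have : cauchy (u @ \oo).
  apply: cauchy_exP => _ /real_eps[e e0 ->].
  have [N uN] := uC e e0; exists (u N); exists N => // n /= Nn.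
  by apply/ball_rnorm/uN.
by move=> /cauchy_cvg ucvg; exists (lim (u @ \oo)).
Qed.

Lemma cvg_rnorm u l : u @ \oo --> l -> rnorm (u n) @[n --> \oo] --> rnorm l.
Proof.
move=> /rcvgP ul; apply/cvgrPdist_lt => e e0.
move/cvgrPdist_lt : ul => /(_ e e0); apply: filterS => n.
rewrite sub0r normrN ger0_norm ?rnorm_ge0// => ule.
rewrite (le_lt_trans _ ule)// ler_norml {2}(rnorm_distC (u n)) lerB_rnorm andbT.
by rewrite lerNl opprB lerB_rnorm.
Qed.

Lemma cvg_bounded (T : {linear H -> H}) (M : R) u l :
  (forall x, rnorm (T x) <= M * rnorm x) ->
  u @ \oo --> l -> T (u n) @[n --> \oo] --> T l.
Proof.
move=> TM /rcvgP ul; apply/rcvgP.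
apply: (@squeeze_cvgr _ _ _ _ (fun=> 0) (fun n => M * rnorm (u n - l))).
- by near=> n; rewrite rnorm_ge0 -linearB TM.
- exact: cvg_cst.
- by rewrite -(mulr0 M); exact: cvgMr.
Unshelve. all: by end_near. Qed.

Lemma cvg_rcauchy u l : u @ \oo --> l -> forall e : R, 0 < e ->
  exists N, forall m n, (N <= m)%N -> (N <= n)%N -> rnorm (u m - u n) < e.
Proof.
move=> /rcvgP/cvgrPdist_lt ul e e0.
have [|N _ uN] := ul (e / 2); first by rewrite divr_gt0.
exists N => m n /uN + /uN; rewrite !sub0r !normrN !ger0_norm ?rnorm_ge0//.
move=> um un; have -> : u m - u n = (u m - l) - (u n - l).
  by rewrite opprB addrA subrK.
by apply: (le_lt_trans (ler_rnormB _ _)); lra.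
Qed.

End convergence.

End real_norm.

(** * Inner products and orthogonality *)

Section inner_product.
Variables (R : realType) (H : completeNormedModType R[i]).
Variable dot : {dot H for Num.conj}.
Hypothesis dot_norm : forall x : H, dot x x = `|x| ^+ 2.
Implicit Types (x y z w : H) (a : R[i]) (V : set H).

Lemma dotC x y : dot x y = Num.conj (dot y x).
Proof. by rewrite hermC expr0 mul1r. Qed.

Lemma dotDl x y z : dot (x + y) z = dot x z + dot y z.
Proof. exact: linearDl. Qed.

Lemma dotDr x y z : dot x (y + z) = dot x y + dot x z.
Proof. exact: linearDr. Qed.

Lemma dotNr x y : dot x (- y) = - dot x y.
Proof. exact: linearNr. Qed.

Lemma dotBl x y z : dot (x - y) z = dot x z - dot y z.
Proof. exact: linearBl. Qed.

Lemma dotBr x y z : dot x (y - z) = dot x y - dot x z.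
Proof. exact: linearBr. Qed.

Lemma dotZl a x y : dot (a *: x) y = a * dot x y.
Proof. exact: linearZl. Qed.

Lemma dotZr a x y : dot x (a *: y) = Num.conj a * dot x y.
Proof. exact: linearZr. Qed.

Lemma dot0l x : dot 0 x = 0.
Proof. exact: linear0l. Qed.

Lemma dot0r x : dot x 0 = 0.
Proof. exact: linear0r. Qed.

Lemma dotxx x : dot x x = (rnorm x)%:C ^+ 2.
Proof. by rewrite dot_norm rnormE. Qed.

Lemma Re_dotxx x : Re (dot x x) = rnorm x ^+ 2.
Proof. by rewrite dotxx -rmorphXn. Qed.

Lemma Re_dotC x y : Re (dot x y) = Re (dot y x).
Proof. by rewrite dotC ReJ. Qed.

Lemma rnorm_dotC x y : rnorm (dot x y) = rnorm (dot y x).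
Proof. by rewrite dotC rnormJ. Qed.

Lemma sqr_rnormD x y :
  rnorm (x + y) ^+ 2 = rnorm x ^+ 2 + rnorm y ^+ 2 + 2 * Re (dot x y).
Proof.
rewrite -!Re_dotxx dotDl !dotDr !raddfD /= (Re_dotC y x); lra.
Qed.

Lemma sqr_rnormB x y :
  rnorm (x - y) ^+ 2 = rnorm x ^+ 2 + rnorm y ^+ 2 - 2 * Re (dot x y).
Proof. by rewrite sqr_rnormD rnormN dotNr raddfN /= mulrN. Qed.

Lemma dot_eq0 x : (forall y, dot y x = 0) -> x = 0.
Proof.
move=> /(_ x); rewrite dot_norm => /eqP; rewrite expf_eq0/= normr_eq0.
by move/eqP.
Qed.

Lemma dot_inj x y : (forall z, dot z x = dot z y) -> x = y.
Proof.
move=> xy; apply/eqP; rewrite -subr_eq0; apply/eqP/dot_eq0 => z.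
by rewrite dotBr xy subrr.
Qed.

(** With q = |y| and d = <x, y>, the vector q^2 x - d y is q^2 times the component of x orthogonal
    to y; expanding its square norm gives the inequality without dividing. *)
Lemma cauchy_schwarz x y : rnorm (dot x y) <= rnorm x * rnorm y.
Proof.
have [->|y0] := eqVneq y 0; first by rewrite dot0r !rnorm0 mulr0.
pose p := rnorm x; pose q := rnorm y; pose d := dot x y.
have q0 : 0 < q by rewrite /q rnorm_gt0.
have E : (rnorm (q%:C ^+ 2 *: x - d *: y))%:C ^+ 2 =
    q%:C ^+ 2 * (q%:C ^+ 2 * p%:C ^+ 2 - (rnorm d)%:C ^+ 2).
  rewrite -dotxx !(dotBl, dotBr, dotZl, dotZr) !dotxx (dotC y x) sqr_rnorm.
  by rewrite rmorphXn /= conj_realC -/d -/p -/q; ring.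
have : 0 <= q ^+ 2 * (q ^+ 2 * p ^+ 2 - rnorm d ^+ 2).
  rewrite -ler0c !(rmorphM, rmorphB, rmorphXn) /= -E -rmorphXn /= ler0c.
  exact: sqr_ge0.
rewrite pmulr_rge0 ?exprn_gt0// subr_ge0 -exprMn mulrC.
by rewrite ler_pXn2r// nnegrE ?rnorm_ge0// mulr_ge0 ?rnorm_ge0.
Qed.

Lemma rnorm_le_dot x (M : R) : 0 <= M ->
  (forall y, rnorm (dot y x) <= M * rnorm y) -> rnorm x <= M.
Proof.
move=> M0 /(_ x); rewrite dotxx -rmorphXn /= rnormC ger0_norm ?sqr_ge0// expr2.
have [->|x0] := eqVneq x 0; first by rewrite rnorm0.
by rewrite ler_pM2r// rnorm_gt0.
Qed.

Definition seq_closed V :=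
  forall (u : nat -> H) l, (forall n, V (u n)) -> u @ \oo --> l -> V l.

Definition subspace V :=
  V 0 /\ forall a x y, V x -> V y -> V (a *: x + y).

Lemma subspaceZ V a x : subspace V -> V x -> V (a *: x).
Proof. by move=> [V0 VP] Vx; rewrite -[_ *: _]addr0; exact: VP. Qed.

Lemma subspaceD V x y : subspace V -> V x -> V y -> V (x + y).
Proof. by move=> [V0 VP] Vx Vy; rewrite -[x]scale1r; exact: VP. Qed.

Lemma subspaceB V x y : subspace V -> V x -> V y -> V (x - y).
Proof.
by move=> sV Vx Vy; rewrite -scaleN1r; apply: subspaceD => //; exact: subspaceZ.
Qed.

Lemma parallelogram x y :
  rnorm (x - y) ^+ 2 = 2 * rnorm x ^+ 2 + 2 * rnorm y ^+ 2 - rnorm (x + y) ^+ 2.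
Proof. by rewrite sqr_rnormB sqr_rnormD; lra. Qed.

(* The nonzero vector is [x0 - v] for [v] the point of [V] nearest to [x0]. *)
Lemma orthogonal_exists V : subspace V -> seq_closed V -> ~ V = setT ->
  exists2 z, z != 0 & forall v, V v -> dot v z = 0.
Proof.
move=> sV cV VT.
have [x0 Vx0] : exists x0, ~ V x0.
  by apply/existsNP => VA; apply: VT; apply/seteqP; split.
pose D := [set rnorm (x0 - v) | v in V].
have D0 : has_inf D.
  split; first by exists (rnorm (x0 - 0)); exists 0 => //; case: sV.
  by exists 0 => _ [v _ <-]; exact: rnorm_ge0.
pose d := inf D.
have dle v : V v -> d <= rnorm (x0 - v).
  by move=> Vv; apply: ge_inf; [case: D0|exists v].
have d0 : 0 <= d.
  by apply: lb_le_inf; [case: D0|move=> _ [v _ <-]; exact: rnorm_ge0].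
have uex n : exists v, V v /\ rnorm (x0 - v) < d + n.+1%:R^-1.
  have [|_ [v Vv <-] lt] := @inf_adherent _ D n.+1%:R^-1 _ D0; last by exists v.
  by rewrite invr_gt0 ltr0n.
have [u uP] := choice uex.
(* Parallelogram law for x0 - u_m and x0 - u_n: half their sum is x0 minus a midpoint lying in [V],
   hence has norm at least [d]. *)
have uC m n : rnorm (u m - u n) ^+ 2 <=
    2 * rnorm (x0 - u m) ^+ 2 + 2 * rnorm (x0 - u n) ^+ 2 - 4 * d ^+ 2.
  have -> : u m - u n = (x0 - u n) - (x0 - u m).
    by rewrite opprB [RHS]addrC addrA subrK.
  rewrite parallelogram.
  have -> : x0 - u n + (x0 - u m) = 2%:R%:C *: (x0 - 2%:R^-1%:C *: (u n + u m)).
    rewrite scalerBr scalerA -rmorphM /= divff ?pnatr_eq0// scale1r.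
    by rewrite rmorph_nat scaler_nat mulr2n opprD addrACA.
  rewrite rnormZ rnormC ger0_norm// exprMn.
  have : d <= rnorm (x0 - 2%:R^-1%:C *: (u n + u m)).
    apply: dle; apply: subspaceZ => //.
    by apply: subspaceD => //; [case: (uP n)|case: (uP m)].
  rewrite -(@ler_pXn2r _ 2) ?nnegrE ?rnorm_ge0//.
  by move=> ?; lra.
have ud : rnorm (x0 - u n) @[n --> \oo] --> d.
  apply: (@squeeze_cvgr _ _ _ _ (fun=> d) (fun n => d + n.+1%:R^-1)).
  - by apply: nearW => n; have [Vu /ltW ->] := uP n; rewrite dle.
  - exact: cvg_cst.
  - rewrite -[X in _ --> X]addr0; apply: cvgD; first exact: cvg_cst.
    exact: cvg_harmonic.
have [l ul] : exists l : H, u @ \oo --> l.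
  apply: rcauchy_cvg => e e0.
  have h : rnorm (x0 - u n) ^+ 2 @[n --> \oo] --> d ^+ 2.
    by rewrite [X in _ --> X]expr2; under eq_fun do rewrite expr2; exact: cvgM.
  have [|N _ hN] := cvgr_dist_lt _ _ h (e ^+ 2 / 8).
    by rewrite divr_gt0// exprn_gt0.
  exists N => m n /hN + /hN.
  rewrite !ltr_norml => /andP[hm _] /andP[hn _].
  rewrite -(@ltr_pXn2r _ 2) ?nnegrE ?rnorm_ge0 ?ltW//.
  by apply: (le_lt_trans (uC m n)); have := exprn_gt0 2 e0; lra.
have Vl : V l by apply: cV ul => n; case: (uP n).
have zd : rnorm (x0 - l) = d.
  apply: (cvg_unique _ _ ud) => //; apply: cvg_rnorm.
  by apply: cvgB => //; exact: cvg_cst.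
exists (x0 - l); first by rewrite subr_eq0; apply/eqP => x0l; rewrite x0l in Vx0.
set z := x0 - l => v Vv.
have [->|v0] := eqVneq v 0; first by rewrite dot0l.
pose q := rnorm v; have q0 : 0 < q by rewrite /q rnorm_gt0.
(* [t *: v] is the projection of [z] on [v]; subtracting it gives d^2 <= d^2 - |c|^2 / q^2, so [c]
   vanishes. *)
pose c := dot z v; pose t := c * (q ^- 2)%:C.
have : d <= rnorm (z - t *: v).
  rewrite /z -addrA -opprD; apply: dle; apply: subspaceD => //.
  exact: subspaceZ.
rewrite -zd -(@ler_pXn2r _ 2) ?nnegrE ?rnorm_ge0// (sqr_rnormB z (t *: v)).
have Et : Re (dot z (t *: v)) = rnorm c ^+ 2 / q ^+ 2.
  rewrite dotZr rmorphM /= conj_realC -/c mulrAC [_ * c]mulrC.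
  by rewrite -sqr_rnorm -rmorphXn -rmorphM.
have Es : rnorm (t *: v) ^+ 2 = rnorm c ^+ 2 / q ^+ 2.
  rewrite rnormZ rnormM rnormC ger0_norm ?invr_ge0 ?sqr_ge0// -/q.
  by field; rewrite gt_eqF.
rewrite Et Es -/z => h; have {h} : rnorm c ^+ 2 / q ^+ 2 <= 0 by lra.
rewrite pmulr_lle0 ?invr_gt0 ?exprn_gt0// => h.
apply/eqP; rewrite -rnorm_eq0 rnorm_dotC -[_ == _](expf_eq0 _ 2) eq_le h.
by rewrite sqr_ge0.
Qed.

End inner_product.

Definition mklin (R : realType) (H : completeNormedModType R[i]) (f : H -> H)
    (fl : linear f) : {linear H -> H} :=
  HB.pack f (GRing.isLinear.Build _ _ _ _ f fl).

(** * Coercive operators, Riesz representation and bounded adjoints *)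

Section operators.
Variables (R : realType) (H : completeNormedModType R[i]).
Variable dot : {dot H for Num.conj}.
Hypothesis dot_norm : forall x : H, dot x x = `|x| ^+ 2.
Implicit Types (x y z w : H) (a : R[i]) (V : set H) (S T : {linear H -> H}).

Definition bounded_by (T : H -> H) (M : R) :=
  forall x, rnorm (T x) <= M * rnorm x.

Lemma coercive_bounded_below S (d : R) :
  (forall x, d * rnorm x ^+ 2 <= rnorm (dot (S x) x)) ->
  forall x, d * rnorm x <= rnorm (S x).
Proof.
move=> Sd x; have [->|x0] := eqVneq x 0; first by rewrite rnorm0 mulr0 rnorm_ge0.
rewrite -(@ler_pM2r _ (rnorm x)) ?rnorm_gt0// -mulrA -expr2.
exact: le_trans (Sd x) (cauchy_schwarz dot_norm _ _).
Qed.

(** Lax-Milgram: the range is closed because [S] is bounded below, and a nonzero z orthogonal to it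
    would satisfy <S z, z> = 0, against coercivity. *)
Lemma coercive_surjective S (d M : R) : 0 < d -> bounded_by S M ->
  (forall x, d * rnorm x ^+ 2 <= rnorm (dot (S x) x)) ->
  forall y, exists x, S x = y.
Proof.
move=> d0 SM Sd; have Sb := coercive_bounded_below Sd.
suff VT : range S = setT.
  by move=> y; have [x _ <-] : range S y by [rewrite VT]; exists x.
apply: contrapT => /orthogonal_exists h.
have [||z z0 zV] := h dot dot_norm.
- split; first by exists 0 => //; rewrite linear0.
  by move=> a _ _ [x _ <-] [y _ <-]; exists (a *: x + y) => //; rewrite linearP.
- move=> u l uV ul; have /choice[w wu] n : exists w, S w = u n.
    by case: (uV n) => w _ <-; exists w.
  have [w0 ww] : exists w0 : H, w @ \oo --> w0.
    apply: rcauchy_cvg => e e0.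
    have [N uN] := cvg_rcauchy ul (mulr_gt0 d0 e0).
    exists N => m n Nm Nn; rewrite -(@ltr_pM2l _ d)//.
    by apply: le_lt_trans (uN m n Nm Nn); rewrite -!wu -linearB; exact: Sb.
  exists w0 => //; apply: (@cvg_unique H _ (u @ \oo)) => //.
  have -> : u = S \o w by apply/funext => n /=; rewrite wu.
  exact: cvg_bounded ww.
- have := Sd z; rewrite zV; last by exists z.
  by rewrite rnorm0 leNgt mulr_gt0// exprn_gt0// rnorm_gt0.
Qed.

(** If the kernel is proper, take z nonzero and orthogonal to it. Since [f z *: x - f x *: z] lies
    in the kernel, a multiple of z represents [f]. *)
Lemma riesz_representation (f : H -> R[i]) (M : R) :
  (forall a x y, f (a *: x + y) = a * f x + f y) ->
  (forall x, rnorm (f x) <= M * rnorm x) ->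
  exists z, forall x, f x = dot x z.
Proof.
move=> fl fM; have f0 : f 0 = 0.
  by have := fl (-1) 0 0; rewrite scaler0 add0r mulN1r addNr.
have fZ a x : f (a *: x) = a * f x by rewrite -[_ *: _]addr0 fl f0 addr0.
have fB x y : f (x - y) = f x - f y.
  by rewrite addrC -scaleN1r fl mulN1r addrC.
have [KT|/orthogonal_exists h] := pselect ([set x | f x = 0] = setT).
  exists 0 => x; rewrite dot0r; have : [set x | f x = 0] x by rewrite KT.
  by [].
have [||z z0 zK] := h dot dot_norm.
- by split=> // a x y /= fx fy; rewrite fl fx fy mulr0 addr0.
- move=> u l /= uK /rcvgP ul; apply/eqP; rewrite -rnorm_eq0 eq_le rnorm_ge0 andbT.
  have hl : M * rnorm (u n - l) @[n --> \oo] --> M * 0 by exact: cvgMr.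
  rewrite mulr0 in hl; rewrite -(cvg_lim _ hl)//.
  apply: limr_ge; first by apply/cvg_ex; exists 0.
  apply: nearW => n; apply: le_trans (fM _).
  by rewrite fB uK sub0r rnormN.
- exists (Num.conj (f z / dot z z) *: z) => x.
  have := zK (f z *: x - f x *: z) => /=.
  rewrite fB !fZ mulrC subrr => /(_ erefl) /eqP.
  rewrite dotBl !dotZl subr_eq0 => /eqP E.
  rewrite dotZr conjCK mulrAC E mulfK//.
  by rewrite dot_norm expf_eq0 normr_eq0.
Qed.

(** Riesz representation provides the vector picked by [xget] as soon as [T] is bounded. *)
Definition adj T x : H := xget 0 [set z | forall y, dot (T y) x = dot y z].

Section adjoint.
Variables (T : {linear H -> H}) (M : R).
Hypothesis TM : bounded_by T M.

Lemma adjP x y : dot (T x) y = dot x (adj T y).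
Proof.
have [|u|z Tz] :=
  @riesz_representation (fun v => dot (T v) y) (M * rnorm y).
- by move=> a v w; rewrite linearP dotDl dotZl.
- rewrite mulrAC; apply: le_trans (cauchy_schwarz dot_norm _ _) _.
  by rewrite ler_wpM2r ?rnorm_ge0.
- have /= := @xgetPex _ 0 [set z | forall v, dot (T v) y = dot v z].
  by apply; exists z.
Qed.

Lemma adj_linear : linear (adj T).
Proof.
move=> a x y; apply: (dot_inj dot_norm) => z.
by rewrite dotDr dotZr -!adjP dotDr dotZr.
Qed.

Lemma adj_bounded : 0 <= M -> bounded_by (adj T) M.
Proof.
move=> M0 x; apply: (rnorm_le_dot dot_norm) => [|y].
  by rewrite mulr_ge0// rnorm_ge0.
rewrite -adjP mulrAC; apply: le_trans (cauchy_schwarz dot_norm _ _) _.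
by rewrite ler_wpM2r ?rnorm_ge0.
Qed.

End adjoint.

End operators.

(** * Compact operators *)

Section compactness.
Variables (R : realType) (H : completeNormedModType R[i]).
Implicit Types (T : H -> H).

(* The selection [f] tends to infinity but need not be increasing. *)
Definition seq_compact T := forall u : nat -> H, (forall n, rnorm (u n) <= 1) ->
  exists f : nat -> nat, (forall n, (n <= f n)%N) /\
    exists l : H, T (u (f n)) @[n --> \oo] --> l.

(** Compactness gives a cluster point l of the sequence T u_n; f n is an index m >= n with T u_m
    within 1/(n+1) of l. *)
Lemma compact_op_seq T : compact_op T -> seq_compact T.
Proof.
move=> [U TU [cU _]] u u1.
have FU : (T (u n) @[n --> \oo]) U.
  by exists 0 => // n _; apply: TU; exists (u n) => /=.
have [l [_ lT]] := cU _ _ FU.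
have /choice[f fP] n : exists m, (n <= m)%N /\ rnorm (l - T (u m)) < n.+1%:R^-1.
  have [||_ [[m /= nm <-] /ball_rnorm h]] :=
    lT [set T (u m) | m in [set m | (n <= m)%N]] (ball l (n.+1%:R^-1)%:C).
  - by exists n => // m /= nm; exists m.
  - by apply: nbhsx_ballx; rewrite ltcR invr_gt0 ltr0n.
  - by exists m.
exists f; split; first by move=> n; case: (fP n).
exists l; apply/rcvgP.
apply: (@squeeze_cvgr _ _ _ _ (fun=> 0) (fun n => n.+1%:R^-1)).
- apply: nearW => n; rewrite rnorm_ge0 rnorm_distC; case: (fP n) => _ /ltW.
  by [].
- exact: cvg_cst.
- exact: cvg_harmonic.
Qed.

Lemma seq_compact_comp T (S : {linear H -> H}) (M : R) :
  seq_compact T -> bounded_by S M -> seq_compact (S \o T).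
Proof.
move=> Tc SM u /Tc[f [fn [l Tl]]]; exists f; split => //; exists (S l) => /=.
exact: (cvg_bounded SM).
Qed.

(** The second hypothesis lets one selection serve both summands; it holds when [S] is the adjoint
    of a normal [T], since then |S x| = |T x|. *)
Lemma seq_compactD T S : seq_compact T ->
  (forall (u : nat -> H) (l : H), T (u n) @[n --> \oo] --> l ->
    exists l' : H, S (u n) @[n --> \oo] --> l') ->
  seq_compact (fun x => T x + S x).
Proof.
move=> Tc TS u /Tc[f [fn [l Tl]]]; exists f; split => //.
by have [l' Sl] := TS (u \o f) l Tl; exists (l + l'); exact: cvgD.
Qed.

End compactness.

(** * Norm-attaining vectors of compact operators *)

Section compact_eigenvectors.
Variables (R : realType) (H : completeNormedModType R[i]).
Variable dot : {dot H for Num.conj}.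
Hypothesis dot_norm : forall x : H, dot x x = `|x| ^+ 2.
Implicit Types (x y z w : H) (a : R[i]) (E : set H) (S T : {linear H -> H}).

(** A relation rather than the function [adj]: taking both operators equal expresses
    self-adjointness. *)
Definition adjoint_pair (T S : H -> H) := forall x y, dot (T x) y = dot x (S y).

(** Let m be the norm of [T] on [E]. Along a maximizing sequence u_n of the unit ball, S T u_n - m^2
    u_n tends to 0; by compactness S T u_n converges along a selection, hence so does u_n when m >
    0, and its limit is the eigenvector. *)
Lemma compact_top_eigenvector T S (MT MS : R) E :
  bounded_by T MT -> bounded_by S MS -> adjoint_pair T S -> seq_compact T ->
  subspace E -> seq_closed E ->
  (forall x, E x -> E (T x)) -> (forall x, E x -> E (S x)) ->
  (exists2 x, E x & x != 0) ->
  exists2 m : R, 0 <= m /\ (forall y, E y -> rnorm (T y) <= m * rnorm y) &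
  exists2 x, E x /\ x != 0 & S (T x) = (m ^+ 2)%:C *: x.
Proof.
move=> TM SM TS Tc sE cE ET ES [x0 Ex0 x00].
pose D := [set rnorm (T x) | x in [set x | E x /\ rnorm x <= 1]].
have E0 : E 0 by case: sE.
have D0 : has_sup D.
  split; first by exists (rnorm (T 0)); exists 0 => //=; rewrite rnorm0.
  exists `|MT| => _ [x [_ x1] <-]; apply: le_trans (TM x) _.
  apply: (@le_trans _ _ (`|MT| * rnorm x)).
    by rewrite ler_wpM2r ?rnorm_ge0// ler_norm.
  by rewrite -[leRHS]mulr1 ler_wpM2l.
pose m := sup D.
have mP x : E x -> rnorm x <= 1 -> rnorm (T x) <= m.
  by move=> Ex x1; apply: ub_le_sup; [case: D0|exists x].
have m0 : 0 <= m by apply: le_trans (mP 0 E0 _); rewrite ?rnorm_ge0// rnorm0.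
have mE x : E x -> rnorm (T x) <= m * rnorm x.
  move=> Ex; have [->|nx] := eqVneq x 0; first by rewrite linear0 rnorm0 mulr0.
  have xp : 0 < rnorm x by rewrite rnorm_gt0.
  rewrite -ler_pdivrMr// mulrC.
  have -> : (rnorm x)^-1 * rnorm (T x) = rnorm (T ((rnorm x)^-1%:C *: x)).
    by rewrite linearZ rnormZ rnormC ger0_norm ?invr_ge0 ?rnorm_ge0.
  apply: mP; first exact: subspaceZ.
  by rewrite rnormZ rnormC ger0_norm ?invr_ge0 ?rnorm_ge0// mulVf ?gt_eqF.
exists m => //.
have [m00|mn0] := eqVneq m 0.
  exists x0 => //; rewrite m00 expr0n scale0r.
  have /eqP -> : T x0 == 0; last by rewrite linear0.
  by rewrite -rnorm_eq0 eq_le rnorm_ge0 andbT; have := mE x0 Ex0; rewrite m00 mul0r.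
have mp : 0 < m by rewrite lt_def mn0.
(* |S y|^2 = <T S y, y> <= m |S y| |y|, because [S] maps [E] into itself. *)
have Sm y : E y -> rnorm (S y) <= m * rnorm y.
  move=> Ey; have [->|nS] := eqVneq (S y) 0.
    by rewrite rnorm0 mulr_ge0// rnorm_ge0.
  rewrite -(@ler_pM2r _ (rnorm (S y))) ?rnorm_gt0// -expr2.
  rewrite -(Re_dotxx dot_norm) -TS; apply: le_trans (ler_Re_rnorm _) _.
  apply: le_trans (cauchy_schwarz dot_norm _ _) _.
  by rewrite mulrAC ler_wpM2r ?rnorm_ge0// mE//; exact: ES.
(* In the expanded square the cross term is -2 m^2 |T x|^2, while the two square norms are at most
   m^2 |T x|^2 and m^4. *)
have key x : E x -> rnorm x <= 1 ->
    rnorm (S (T x) - (m ^+ 2)%:C *: x) ^+ 2 <=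
    m ^+ 2 * (m ^+ 2 - rnorm (T x) ^+ 2).
  move=> Ex x1; rewrite (sqr_rnormB dot_norm) dotZr conj_realC.
  have -> : Re ((m ^+ 2)%:C * dot (S (T x)) x) = m ^+ 2 * rnorm (T x) ^+ 2.
    rewrite dotC -TS (dotxx dot_norm) -rmorphXn conj_realC -rmorphM/=.
    by [].
  rewrite rnormZ rnormC ger0_norm ?sqr_ge0//.
  have h1 : rnorm (S (T x)) ^+ 2 <= m ^+ 2 * rnorm (T x) ^+ 2.
    rewrite -exprMn ler_pXn2r ?nnegrE ?rnorm_ge0 ?mulr_ge0 ?rnorm_ge0//.
    exact/Sm/ET.
  have h2 : (m ^+ 2 * rnorm x) ^+ 2 <= m ^+ 2 * m ^+ 2.
    rewrite exprMn -expr2 -[leRHS]mulr1 ler_wpM2l ?sqr_ge0//.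
    by rewrite expr_le1// rnorm_ge0.
  lra.
have /choice[u uP] n : exists x,
    [/\ E x, rnorm x <= 1 & m - n.+1%:R^-1 < rnorm (T x)].
  have [|_ [x [Ex x1] <-] lt] := @sup_adherent _ D n.+1%:R^-1 _ D0; last by exists x.
  by rewrite invr_gt0 ltr0n.
have [f [fn [y Ty]]] : exists f : nat -> nat, (forall n, (n <= f n)%N) /\
    exists l : H, T (u (f n)) @[n --> \oo] --> l.
  by apply: Tc => n; case: (uP n).
have Tm : rnorm (T (u (f n))) @[n --> \oo] --> m.
  apply: (@squeeze_cvgr _ _ _ _ (fun n => m - n.+1%:R^-1) (fun=> m)).
  - apply: nearW => n; have [Eu u1 /ltW um] := uP (f n); rewrite mP// andbT.
    apply: le_trans um; rewrite lerB// lef_pV2 ?posrE ?ltr0n// ler_nat ltnS.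
    exact: fn.
  - rewrite -[X in _ --> X]subr0; apply: cvgB; first exact: cvg_cst.
    exact: cvg_harmonic.
  - exact: cvg_cst.
have d0 : m ^+ 2 * (m ^+ 2 - rnorm (T (u (f n))) ^+ 2) @[n --> \oo] --> (0 : R).
  have -> : (0 : R) = m ^+ 2 * (m ^+ 2 - m * m) by rewrite expr2 subrr mulr0.
  apply: cvgMr; apply: cvgB; first exact: cvg_cst.
  by under eq_fun do rewrite expr2; exact: cvgM.
have STm : S (T (u (f n))) - (m ^+ 2)%:C *: u (f n) @[n --> \oo] --> (0 : H).
  apply/rcvgP/cvgrPdist_lt => e e0.
  move/cvgrPdist_lt : d0 => /(_ _ (exprn_gt0 2 e0)); apply: filterS => n.
  rewrite !sub0r !normrN subr0 (ger0_norm (rnorm_ge0 _)) => lt.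
  rewrite -(@ltr_pXn2r _ 2) ?nnegrE ?rnorm_ge0 ?ltW//.
  apply: le_lt_trans lt; apply: le_trans (ler_norm _).
  by have [? ? _] := uP (f n); exact: key.
have Sy : S (T (u (f n))) @[n --> \oo] --> S y by exact: (cvg_bounded SM).
have uy : u (f n) @[n --> \oo] --> (m ^- 2)%:C *: S y.
  have -> : (fun n => u (f n)) = (fun n => (m ^- 2)%:C *:
      (S (T (u (f n))) - (S (T (u (f n))) - (m ^+ 2)%:C *: u (f n)))).
    apply/funext => n; rewrite opprB addrC subrK scalerA -rmorphM.
    by rewrite mulVf ?scale1r// expf_eq0 gt_eqF.
  rewrite -[S y]subr0; apply: cvgZr; exact: cvgB.
set x := (m ^- 2)%:C *: S y in uy.
have Tx : T x = y by apply: (cvg_unique _ (cvg_bounded TM uy)).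
have Tnx : rnorm (T x) = m.
  rewrite Tx; apply: (cvg_unique _ _ Tm) => //; exact: cvg_rnorm.
exists x; [split|].
- by apply: cE uy => n; case: (uP (f n)).
- by apply/eqP => x00'; rewrite x00' linear0 rnorm0 in Tnx; rewrite -Tnx eqxx in mn0.
- by rewrite Tx /x scalerA -rmorphM divff ?scale1r// expf_eq0 gt_eqF.
Qed.

End compact_eigenvectors.

(** * Bounded normal operators and their eigenvectors *)

Section normal_operators.
Variables (R : realType) (H : completeNormedModType R[i]).
Variable dot : {dot H for Num.conj}.
Hypothesis dot_norm : forall x : H, dot x x = `|x| ^+ 2.
Variables (T S : {linear H -> H}) (MT MS : R).
Hypothesis TM : bounded_by T MT.
Hypothesis SM : bounded_by S MS.
Hypothesis TS : adjoint_pair dot T S.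
Hypothesis TSC : forall x, T (S x) = S (T x).
Implicit Types (x y z w : H) (a : R[i]).

Lemma adjoint_pair_sym : adjoint_pair dot S T.
Proof. by move=> x y; rewrite dotC -TS -dotC. Qed.

Lemma normal_rnorm x : rnorm (S x) = rnorm (T x).
Proof.
apply/eqP; rewrite -(@eqrXn2 _ 2) ?rnorm_ge0//.
by rewrite -!(Re_dotxx dot_norm) TS -TSC adjoint_pair_sym.
Qed.

(** As [T] commutes with [S], w = S y - conj(mu) y satisfies T w = mu w; then <w, S y> = <T w, y> =
    mu <w, y>, so <w, w> = 0. *)
Lemma normal_adj_eigenvector (mu : R[i]) y :
  T y = mu *: y -> S y = Num.conj mu *: y.
Proof.
move=> Ty; pose w := S y - Num.conj mu *: y.
have Tw : T w = mu *: w.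
  by rewrite linearB TSC linearZ /= Ty linearZ /= scalerBr !scalerA mulrC.
have : dot w w = 0.
  by rewrite {2}/w dotBr -TS Tw dotZr conjCK dotZl subrr.
by rewrite dot_norm => /eqP; rewrite expf_eq0 normr_eq0 subr_eq0 => /eqP.
Qed.

Lemma normal_eigenvectors_orthogonal (nu mu : R[i]) x y :
  nu != mu -> T x = nu *: x -> T y = mu *: y -> dot x y = 0.
Proof.
move=> numu Tx /normal_adj_eigenvector Sy.
have := TS x y; rewrite Tx Sy dotZl dotZr conjCK => /eqP.
by rewrite -subr_eq0 -mulrBl mulf_eq0 subr_eq0 (negbTE numu) => /eqP.
Qed.

(* On the eigenspace of [T* T] for [m^2 = |T|^2], an eigenvector [x] of
   [T + T*] for [a] satisfies [T^2 x - a T x + m^2 x = 0], and this quadratic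
   factors. *)
Lemma normal_compact_eigenvector : seq_compact T -> (exists x : H, x != 0) ->
  exists (nu : R[i]) x,
    [/\ x != 0, T x = nu *: x & forall y, rnorm (T y) <= rnorm nu * rnorm y].
Proof.
move=> Tc [x0 x00].
have [|||||m [m0 mT] [x1 [_ x10] x1m]] :=
  @compact_top_eigenvector _ _ _ dot_norm T S MT MS setT TM SM TS Tc.
- by split.
- by [].
- by [].
- by [].
- by exists x0.
pose E := [set x | S (T x) = (m ^+ 2)%:C *: x].
have sE : subspace E.
  split=> [|a x y]; rewrite /E /=; first by rewrite scaler0 !linear0.
  by move=> Ex Ey; rewrite !linearP Ex Ey.
have cE : seq_closed E.
  move=> u l uE ul; rewrite /E /=.
  apply: (cvg_unique _ (cvg_bounded SM (cvg_bounded TM ul))) => //.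
  have -> : (fun n => S (T (u n))) = (fun n => (m ^+ 2)%:C *: u n).
    by apply/funext => n; exact: uE.
  exact: cvgZr.
have ET x : E x -> E (T x).
  by rewrite /E /= => Ex; rewrite -TSC Ex linearZ.
have ES x : E x -> E (S x).
  by rewrite /E /= => Ex; rewrite TSC Ex linearZ.
(* K = T + S is self-adjoint, preserves [E], and is compact because [S] contracts distances exactly
   as [T] does. *)
have [K KE] : exists K : {linear H -> H}, forall x, K x = T x + S x.
  by exists (T \+ S).
have KM : bounded_by K (MT + MS).
  by move=> x; rewrite KE mulrDl; apply: le_trans (ler_rnormD _ _) _; rewrite lerD.
have EK x : E x -> E (K x).
  by move=> Ex; rewrite KE; apply: subspaceD => //; [exact: ET|exact: ES].
have Kc : seq_compact K.
  have -> : (K : H -> H) = fun x => T x + S x by exact/funext.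
  apply: seq_compactD => // u l Tl; apply: rcauchy_cvg => e e0.
  have [N uN] := cvg_rcauchy Tl e0; exists N => i j Ni Nj.
  by rewrite -linearB normal_rnorm linearB; exact: uN.
have KK : adjoint_pair dot K K.
  by move=> x y; rewrite !KE dotDl dotDr TS adjoint_pair_sym addrC.
have [|k _ [x2 [Ex2 x20] Kx2]] :=
  compact_top_eigenvector dot_norm KM KM KK Kc sE cE EK EK.
  by exists x1.
(* From K^2 x2 = k^2 x2: either x2 is an eigenvector of [K] for k, or K x2 - k x2 is one for -k. *)
have [a [x3 [Ex3 x30 Kx3]]] : exists a x, [/\ E x, x != 0 & K x = a *: x].
  have [Kk|Kk] := eqVneq (K x2) (k%:C *: x2); first by exists k%:C, x2.
  exists (- k%:C), (K x2 - k%:C *: x2); split.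
  - by apply: subspaceB => //; [exact: EK|exact: subspaceZ].
  - by rewrite subr_eq0.
  - rewrite linearB /= Kx2 linearZ /= scaleNr scalerBr scalerA -rmorphM -expr2.
    by rewrite opprB.
(* [z1] and [z2] are the roots of X^2 - a X + m^2. *)
pose r := sqrtC (a ^+ 2 - 4 * (m ^+ 2)%:C).
pose z1 := (a + r) / 2; pose z2 := (a - r) / 2.
have z12 : z1 + z2 = a by rewrite /z1 /z2; field.
have z1z2 : z1 * z2 = (m ^+ 2)%:C.
  have : r ^+ 2 = a ^+ 2 - 4 * (m ^+ 2)%:C by exact: sqrtCK.
  rewrite /z1 /z2 => rr.
  have -> : (a + r) / 2 * ((a - r) / 2) = (a ^+ 2 - r ^+ 2) / 4 by field.
  by rewrite rr; field.
(* As (T - z2) (T - z1) x3 = 0, either x3 or (T - z1) x3 is an eigenvector of [T]. *)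
have [nu [x [Ex x00' Tx]]] : exists nu x, [/\ E x, x != 0 & T x = nu *: x].
  have [Tz|Tz] := eqVneq (T x3) (z1 *: x3); first by exists z1, x3.
  exists z2, (T x3 - z1 *: x3); split.
  - by apply: subspaceB => //; [exact: ET|exact: subspaceZ].
  - by rewrite subr_eq0.
  - have Sx3 : S x3 = a *: x3 - T x3 by rewrite -Kx3 KE addrC addKr.
    have : T (S x3) = (m ^+ 2)%:C *: x3 by rewrite TSC.
    rewrite Sx3 linearB linearZ /= => E1.
    have -> : T (T x3 - z1 *: x3) = T (T x3) - z1 *: T x3.
      by rewrite linearB linearZ.
    have -> : T (T x3) = a *: T x3 - (m ^+ 2)%:C *: x3.
      by rewrite -E1 opprB addrC subrK.
    rewrite -z12 -z1z2 scalerDl scalerBr scalerA (mulrC z2).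
    by rewrite -[X in X - _]addrA [X in X - _]addrC addrK.
exists nu, x; split => // y.
(* On [E], |T x|^2 = <x, S T x> = m^2 |x|^2, so every eigenvalue of [T] there has modulus m. *)
suff -> : rnorm nu = m by exact: mT.
apply: (@mulIf _ (rnorm x)); first by rewrite rnorm_eq0.
rewrite -rnormZ -Tx; apply/eqP.
rewrite -(@eqrXn2 _ 2) ?rnorm_ge0 ?mulr_ge0 ?rnorm_ge0//.
rewrite -(Re_dotxx dot_norm) TS Ex dotZr conj_realC (dotxx dot_norm).
by rewrite -rmorphXn -rmorphM /= exprMn.
Qed.

End normal_operators.

(** * Resolvents of unbounded operators *)

Section operator_norm.
Variables (R : realType) (H : completeNormedModType R[i]).
Implicit Types T : {linear H -> H}.

Lemma opnorm_le T (M : R) : 0 <= M -> bounded_by T M -> (opnorm T <= M%:E)%E.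
Proof.
move=> M0 TM; apply: ge_ereal_sup => _ [x /= x1 <-]; rewrite lee_fin.
by apply: le_trans (TM x) _; rewrite -[leRHS]mulr1 ler_wpM2l.
Qed.

Lemma opnorm_ge0 T : (0 <= opnorm T)%E.
Proof.
apply: ereal_sup_ubound; exists 0 => /=; first by rewrite rnorm0.
by rewrite linear0 rnorm0.
Qed.

Lemma opnorm_bounded_by T (r : R) : opnorm T = r%:E -> bounded_by T r.
Proof.
move=> Tr x; have [->|x0] := eqVneq x 0; first by rewrite linear0 rnorm0 mulr0.
have xp : 0 < rnorm x by rewrite rnorm_gt0.
rewrite -ler_pdivrMr// mulrC.
have -> : (rnorm x)^-1 * rnorm (T x) = rnorm (T ((rnorm x)^-1%:C *: x)).
  by rewrite linearZ rnormZ rnormC ger0_norm ?invr_ge0 ?rnorm_ge0.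
rewrite -lee_fin -Tr; apply: ereal_sup_ubound.
exists ((rnorm x)^-1%:C *: x) => //=.
by rewrite rnormZ rnormC ger0_norm ?invr_ge0 ?rnorm_ge0// mulVf ?gt_eqF.
Qed.

End operator_norm.

Section resolvent.
Variables (R : realType) (H : completeNormedModType R[i]).
Variable A : linop H.
Implicit Types (x y z : H) (s lambda mu : R[i]).

Let shift s x := A x - s *: x.

Lemma dom_sub x y : dom A x -> dom A y -> dom A (x - y).
Proof. by move=> Ax Ay; rewrite addrC -scaleN1r; exact: domP. Qed.

Lemma domZ (a : R[i]) x : dom A x -> dom A (a *: x).
Proof. by move=> Ax; rewrite -[_ *: _]addr0; apply: domP => //; exact: dom0. Qed.

Lemma app0 : A 0 = 0.
Proof.
have := Defs.appP (-1) (dom0 A) (dom0 A).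
by rewrite scaler0 add0r scaleN1r addNr.
Qed.

Lemma appZ (a : R[i]) x : dom A x -> A (a *: x) = a *: A x.
Proof.
move=> Ax; rewrite -[a *: x]addr0 Defs.appP//; last exact: dom0.
by rewrite app0 addr0.
Qed.

Lemma shiftP s (a : R[i]) x y : dom A x -> dom A y ->
  shift s (a *: x + y) = a *: shift s x + shift s y.
Proof.
move=> Ax Ay; rewrite /shift Defs.appP// !scalerDr scalerN !scalerA (mulrC s) opprD.
by rewrite addrACA.
Qed.

Lemma shift_sub s x y : dom A x -> dom A y ->
  shift s (x - y) = shift s x - shift s y.
Proof. by move=> Ax Ay; rewrite addrC -scaleN1r shiftP// scaleN1r addrC. Qed.

Lemma resolvent_setI lambda (M : R) : 0 <= M ->
  (forall y, exists2 x, dom A x & A x - lambda *: x = y) ->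
  (forall x, dom A x -> rnorm x <= M * rnorm (A x - lambda *: x)) ->
  resolvent_set A lambda /\ (opnorm (resolvent A lambda) <= M%:E)%E.
Proof.
move=> M0 surj low.
have inj x y : dom A x -> dom A y -> shift lambda x = shift lambda y -> x = y.
  move=> Ax Ay xy; have := low _ (dom_sub Ax Ay).
  rewrite -/(shift lambda (x - y)) shift_sub// xy subrr rnorm0 mulr0.
  by move=> h; apply/eqP; rewrite -subr_eq0 -rnorm_eq0 eq_le h rnorm_ge0.
have RP y : dom A (resolvent A lambda y) /\ shift lambda (resolvent A lambda y) = y.
  by rewrite /resolvent; case: xgetP => [x -> //|/(_ _)]; case: (surj y) => x Ax xy /(_ x); case.
have le : (opnorm (resolvent A lambda) <= M%:E)%E.
  apply: ge_ereal_sup => _ [y /= y1 <-]; rewrite lee_fin.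
  have [Ay Ey] := RP y; apply: le_trans (low _ Ay) _.
  by rewrite -/(shift lambda _) Ey -[leRHS]mulr1 ler_wpM2l.
split => //; split; last exact: le_lt_trans le (ltry _).
split => //; first by move=> x y /set_mem Ax /set_mem Ay; exact: inj.
by move=> y _; have [x Ax xy] := surj y; exists x.
Qed.

Section in_resolvent_set.
Variable s : R[i].
Hypothesis sA : resolvent_set A s.
Local Notation Rs := (resolvent A s).

Lemma resolvent_dom_eq y : dom A (Rs y) /\ A (Rs y) - s *: Rs y = y.
Proof.
have [[_ _ /(_ y I)[x Ax xy]] _] := sA.
by rewrite /resolvent; case: xgetP => [z -> //|/(_ x)]; case.
Qed.

Lemma resolvent_dom y : dom A (Rs y).
Proof. by case: (resolvent_dom_eq y). Qed.

Lemma resolvent_eq y : A (Rs y) - s *: Rs y = y.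
Proof. by case: (resolvent_dom_eq y). Qed.

Lemma app_resolvent y : A (Rs y) = y + s *: Rs y.
Proof. by apply/eqP; rewrite -subr_eq resolvent_eq. Qed.

Lemma resolventK x : dom A x -> Rs (A x - s *: x) = x.
Proof.
move=> Ax; have [[_ inj _] _] := sA.
by apply: inj; rewrite ?resolvent_eq//; apply/mem_set => //; exact: resolvent_dom.
Qed.

Lemma resolvent_linear : linear Rs.
Proof.
move=> a x y; rewrite -[RHS]resolventK; last by apply: domP; exact: resolvent_dom.
congr Rs; rewrite -/(shift s _) shiftP; try exact: resolvent_dom.
by rewrite /shift !resolvent_eq.
Qed.

Lemma resolvent_fine : opnorm Rs = (fine (opnorm Rs))%:E.
Proof.
rewrite fineK// ge0_fin_numE; first by case: sA.
exact: (opnorm_ge0 (mklin resolvent_linear)).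
Qed.

Lemma resolvent_bounded : bounded_by Rs (fine (opnorm Rs)).
Proof. exact: (opnorm_bounded_by (T := mklin resolvent_linear)) resolvent_fine. Qed.

Lemma resolvent_fine_ge0 : 0 <= fine (opnorm Rs).
Proof.
by rewrite -lee_fin -resolvent_fine (opnorm_ge0 (mklin resolvent_linear)).
Qed.

Lemma resolvent_inj0 y : Rs y = 0 -> y = 0.
Proof. by move=> Ry; rewrite -(resolvent_eq y) Ry app0 scaler0 subrr. Qed.

Lemma resolvent_fine_gt0 : (exists x : H, x != 0) -> 0 < fine (opnorm Rs).
Proof.
move=> [x x0]; rewrite lt_def resolvent_fine_ge0 andbT; apply: contra_neq x0 => r0.
apply: resolvent_inj0; apply/eqP; rewrite -rnorm_eq0 eq_le rnorm_ge0 andbT.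
by have := resolvent_bounded x; rewrite r0 mul0r.
Qed.

Variable dot : {dot H for Num.conj}.
Hypothesis dot_norm : forall x : H, dot x x = `|x| ^+ 2.

(* [A - lambda = - mu^-1 (R_s - mu) (A - s)] for [mu = (lambda - s)^-1]. *)
Lemma resolvent_set_coercive mu (d : R) : mu != 0 -> 0 < d ->
  (forall x, rnorm x = 1 -> d <= rnorm (dot (Rs x) x - mu)) ->
  resolvent_set A (s + mu^-1) /\
  (opnorm (resolvent A (s + mu^-1)%R) <=
    (rnorm mu * fine (opnorm Rs) / d)%:E)%E.
Proof.
move=> mu0 d0 dP; set r := fine _.
pose T := mklin resolvent_linear.
have r0 : 0 <= r by exact: resolvent_fine_ge0.
have [S SE] : exists S : {linear H -> H}, forall x, S x = Rs x - mu *: x.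
  suff Sl : linear (fun x => Rs x - mu *: x) by exists (mklin Sl).
  move=> a x y.
  rewrite -[Rs]/(T : H -> H) linearP !scalerDr scalerN !scalerA (mulrC mu) opprD.
  by rewrite addrACA.
(* By homogeneity it suffices to treat unit vectors, where <S x, x> = <R_s x, x> - mu. *)
have Scoer x : d * rnorm x ^+ 2 <= rnorm (dot (S x) x).
  have [->|x0] := eqVneq x 0.
    by rewrite rnorm0 expr0n mulr0 rnorm_ge0.
  have xp : 0 < rnorm x by rewrite rnorm_gt0.
  pose y := (rnorm x)^-1%:C *: x.
  have y1 : rnorm y = 1.
    by rewrite rnormZ rnormC ger0_norm ?invr_ge0 ?rnorm_ge0// mulVf ?gt_eqF.
  have -> : x = (rnorm x)%:C *: y.
    by rewrite scalerA -rmorphM divff ?gt_eqF// scale1r.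
  have -> : S ((rnorm x)%:C *: y) = (rnorm x)%:C *: S y by rewrite linearZ.
  rewrite dotZl dotZr conj_realC !rnormM !rnormC rnormZ y1 rnormC.
  rewrite !ger0_norm ?rnorm_ge0// mulr1 mulrA -expr2 mulrC.
  rewrite ler_wpM2l ?sqr_ge0// SE dotBl dotZl (dotxx dot_norm) y1.
  by rewrite expr1n mulr1; exact: dP.
have SM : bounded_by S (r + rnorm mu).
  move=> x; rewrite SE mulrDl; apply: le_trans (ler_rnormB _ _) _.
  by rewrite rnormZ lerD2r; exact: resolvent_bounded.
have Ssurj := coercive_surjective dot_norm d0 SM Scoer.
have Slow := coercive_bounded_below dot_norm Scoer.
have AS x : dom A x -> A x - (s + mu^-1) *: x = - mu^-1 *: S (A x - s *: x).
  move=> Ax; rewrite SE resolventK// scalerBr scaleNr scaleNr opprK scalerA.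
  by rewrite mulVf// scale1r scalerDl opprD addrA addrC.
apply: resolvent_setI.
- by rewrite !mulr_ge0 ?rnorm_ge0// invr_ge0 ltW.
(* The factor -mu cancels the -mu^-1 of [AS], which makes R_s w a preimage of y. *)
- move=> y; have [w Sw] := Ssurj (- mu *: y).
  exists (Rs w); first exact: resolvent_dom.
  rewrite AS; last exact: resolvent_dom.
  by rewrite resolvent_eq Sw scalerA mulrNN mulVf// scale1r.
- move=> x Ax; rewrite AS// rnormZ rnormN rnormV.
  have mup : 0 < rnorm mu by rewrite rnorm_gt0.
  set w := A x - s *: x.
  have -> : rnorm mu * r / d * ((rnorm mu)^-1 * rnorm (S w)) = r * (rnorm (S w) / d).
    by field; rewrite !gt_eqF.
  rewrite -{1}(resolventK Ax) -/w; apply: le_trans (resolvent_bounded _) _.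
  by rewrite ler_wpM2l// ler_pdivlMr// mulrC.
Qed.

Lemma rnorm_dot_resolvent x : rnorm x = 1 ->
  rnorm (dot (Rs x) x) <= fine (opnorm Rs).
Proof.
move=> x1; apply: le_trans (cauchy_schwarz dot_norm _ _) _.
by rewrite x1 mulr1; have := resolvent_bounded x; rewrite x1 mulr1.
Qed.

(** The numerical range of R_s lies in the disc of radius |R_s|, so d = |mu| - |R_s| is admissible
    in [resolvent_set_coercive]. *)
Lemma resolvent_set_near mu : fine (opnorm Rs) < rnorm mu ->
  resolvent_set A (s + mu^-1) /\
  (opnorm (resolvent A (s + mu^-1)%R) <=
    (rnorm mu * fine (opnorm Rs) / (rnorm mu - fine (opnorm Rs)))%:E)%E.
Proof.
move=> rmu; apply: resolvent_set_coercive.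
- by rewrite -rnorm_gt0 (le_lt_trans resolvent_fine_ge0).
- by rewrite subr_gt0.
- move=> x x1; rewrite rnorm_distC; apply: le_trans (lerB_rnorm _ _).
  by rewrite lerB// rnorm_dot_resolvent.
Qed.

End in_resolvent_set.

End resolvent.

(** * The two enclosures *)

Section plane_sets_theory.
Variable R : realType.
Implicit Types (z s w : R[i]) (U : set R[i]).

Lemma shift_inv_setP U s z :
  shift_set (inv_set U) s z <-> z != s /\ U (z - s)^-1.
Proof.
split=> [[_ [w [Uw /= w0] <-] <-]|[zs Uz]].
  rewrite addrK invrK; split => //; rewrite -subr_eq0 addrK invr_eq0.
  exact/eqP.
exists (z - s); last by rewrite subrK.
exists (z - s)^-1; last by rewrite invrK.
by split => //=; apply/eqP; rewrite invr_eq0 subr_eq0.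
Qed.

Lemma nbhdP (e : R) U z : nbhd e U z <-> exists2 w, U w & rnorm (z - w) < e.
Proof.
split=> [/ereal_inf_lt[_ [w Uw <-]]|[w Uw lt]].
  by rewrite lte_fin => lt; exists w.
apply: (@le_lt_trans _ _ (rnorm (z - w))%:E); last by rewrite lte_fin.
by apply: ereal_inf_lbound; exists w.
Qed.

(** Moving z towards w by the fraction d / (e + d) of the way brings it within e of w, at a
    displacement smaller than d. *)
Lemma closure_nbhd (e : R) U z : 0 < e ->
  (forall d, 0 < d -> exists2 w, U w & rnorm (z - w) < e + d) ->
  closure_set (nbhd e U) z.
Proof.
move=> e0 zU B /nbhs_ballP[_ /= /real_eps[d d0 ->] dB].
have [w Uw lt] := zU d d0.
pose t := d / (e + d); have ed : 0 < e + d by rewrite addr_gt0.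
have t0 : 0 < t by rewrite divr_gt0.
have Et : 1 - t = e / (e + d) by rewrite /t; field; rewrite gt_eqF.
exists (z - t%:C * (z - w)); split.
  apply/nbhdP; exists w => //.
  have -> : z - t%:C * (z - w) - w = (1 - t)%:C * (z - w).
    by rewrite rmorphB rmorph1 mulrBl mul1r addrAC.
  rewrite rnormM rnormC ger0_norm; last by rewrite Et divr_ge0 ?ltW.
  by rewrite Et mulrAC ltr_pdivrMr// ltr_pM2l.
apply/dB/(@ball_rnorm R R[i]^o); rewrite opprB addrC subrK.
rewrite (_ : rnorm _ = rnorm (t%:C * (z - w))) // rnormM rnormC ger0_norm ?ltW//.
by rewrite /t mulrAC ltr_pdivrMr// ltr_pM2l.
Qed.

Lemma closure_disc_le (L : R) z : closure_set (disc L) z -> rnorm z <= L.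
Proof.
move=> zL; apply/ler_addgt0Pr => e e0.
have [|w [wL /(@ball_rnorm R R[i]^o) zw]] := zL (ball (z : R[i]^o) e%:C).
  by apply: nbhsx_ballx; rewrite ltcR.
have -> : z = (z - w) + w by rewrite subrK.
apply: le_trans (ler_rnormD _ _) _; rewrite addrC lerD// ltW//.
Qed.

End plane_sets_theory.

Section enclosures.
Variables (R : realType) (H : completeNormedModType R[i]).
Variable dot : {dot H for Num.conj}.
Hypothesis dot_norm : forall x : H, dot x x = `|x| ^+ 2.
Hypothesis H_neq0 : exists x : H, x != 0.
Variable A : linop H.
Variable eps : R.
Hypothesis eps0 : 0 < eps.
Implicit Types (s lambda : R[i]) (gamma : R).

Lemma resolvent_normE lambda : resolvent_set A lambda ->
  resolvent_norm A lambda = opnorm (resolvent A lambda).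
Proof. by move=> lA; rewrite /resolvent_norm; case: asboolP. Qed.

Lemma level_set_fine gamma s : level_set A eps gamma s ->
  fine (opnorm (resolvent A s)) = (eps + gamma)^-1.
Proof. by move=> [_ ->]. Qed.

(** This value is also 1/gamma - 1/(eps + gamma), the gap between the modulus 1/gamma and the radius
    |R_s| of a disc containing the numerical range. *)
Lemma delta_level_set gamma s : 0 < gamma -> level_set A eps gamma s ->
  delta A eps s = eps / (gamma * (eps + gamma)).
Proof.
move=> g0 /level_set_fine; rewrite /delta => ->.
by field; rewrite !gt_eqF ?addr_gt0//; lra.
Qed.

(** Put p = |lambda - s|. If 0 < p < gamma, perturbation from [s] gives |R_lambda| <= 1/(eps + gamma
    - p) < 1/eps; if p = 0, the norm is 1/(eps + gamma). *)
Lemma level_set_far gamma s lambda : 0 < gamma -> level_set A eps gamma s ->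
  ((eps^-1)%:E <= resolvent_norm A lambda)%E -> gamma <= rnorm (lambda - s).
Proof.
move=> g0 sl le; rewrite leNgt; apply/negP => lt.
have [sA sE] := sl; have rE := level_set_fine sl.
have eg : 0 < eps + gamma by rewrite addr_gt0.
have [E|ls] := eqVneq lambda s.
  move: le; rewrite E resolvent_normE// sE lee_fin lef_pV2 ?posrE//.
  by lra.
have lsp : 0 < rnorm (lambda - s) by rewrite rnorm_gt0 subr_eq0.
have [|lA lle] := resolvent_set_near sA dot_norm (mu := (lambda - s)^-1).
  by rewrite rE rnormV ltf_pV2 ?posrE// (lt_trans lt)// ltrDr.
rewrite invrK addrC subrK in lA lle.
move: le; rewrite resolvent_normE// => /le_trans/(_ lle).
rewrite rE rnormV lee_fin; move: lt lsp; move: (rnorm _) => p lt p0.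
have egp : 0 < eps + gamma - p.
  by rewrite subr_gt0 (lt_trans lt)// ltrDr.
have -> : p^-1 / (eps + gamma) / (p^-1 - (eps + gamma)^-1) = (eps + gamma - p)^-1.
  by field; rewrite !gt_eqF.
by rewrite lef_pV2 ?posrE// -addrA gerDl subr_le0 leNgt lt.
Qed.

(** The bound |mu| |R_s| / d, with |mu| <= 1/gamma and |R_s| = 1/(eps + gamma). For d = delta_s it
    is exactly 1/eps. *)
Lemma resolvent_norm_numerical_range gamma s lambda (d : R) :
  0 < gamma -> level_set A eps gamma s -> gamma <= rnorm (lambda - s) -> 0 < d ->
  (forall w, numerical_range dot (resolvent A s) w ->
    d <= rnorm ((lambda - s)^-1 - w)) ->
  (resolvent_norm A lambda <= ((gamma * (eps + gamma) * d)^-1)%:E)%E.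
Proof.
move=> g0 sl far d0 dW; have [sA sE] := sl.
have lsp : 0 < rnorm (lambda - s) by exact: lt_le_trans far.
have ls : lambda - s != 0 by rewrite -rnorm_gt0.
have eg : 0 < eps + gamma by rewrite addr_gt0.
have [||lA lle] := resolvent_set_coercive sA dot_norm
  (mu := (lambda - s)^-1) _ d0.
- by rewrite invr_eq0.
- by move=> x x1; rewrite rnorm_distC; apply: dW; exists x.
rewrite invrK addrC subrK in lA lle.
rewrite resolvent_normE//; apply: le_trans lle _.
rewrite lee_fin (level_set_fine sl) rnormV !invfM ler_wpM2r ?invr_ge0 ?(ltW d0)//.
by rewrite ler_wpM2r ?invr_ge0 ?(ltW eg)// lef_pV2 ?posrE.
Qed.

(** If (lambda - s)^-1 were at distance at least delta_s from every point of the numerical range,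
    |R_lambda| would be at most 1/eps. *)
Lemma pseudospectrum_sub_enclosure :
  pseudospectrum A eps `<=` enclosure A dot eps.
Proof.
move=> lambda /= lam gamma g0 s sl; apply/shift_inv_setP.
have far := level_set_far g0 sl (ltW lam).
have lsp : 0 < rnorm (lambda - s) by exact: lt_le_trans far.
split; first by rewrite -subr_eq0 -rnorm_gt0.
apply: contrapT => /nbhdP N; move: lam; apply/negP; rewrite -leNgt.
have eg : 0 < eps + gamma by rewrite addr_gt0.
rewrite (delta_level_set g0 sl) in N.
have d0 : 0 < eps / (gamma * (eps + gamma)) by rewrite divr_gt0 ?mulr_gt0.
apply: le_trans (resolvent_norm_numerical_range g0 sl far d0 _) _.
  by move=> w Ww; rewrite leNgt; apply/negP => lt; apply: N; exists w.
by rewrite lee_fin mulrC divfK// mulf_neq0 ?gt_eqF.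
Qed.

(** Separation by delta_s + e with e > 0 would make |R_lambda| strictly smaller than 1/eps; so some
    point of the numerical range is closer than that, for each e. *)
Lemma resolvent_norm_ge_sub_closed_enclosure lambda :
  ((eps^-1)%:E <= resolvent_norm A lambda)%E -> closed_enclosure A dot eps lambda.
Proof.
move=> lam gamma /= g0 s sl; apply/shift_inv_setP.
have far := level_set_far g0 sl lam.
have lsp : 0 < rnorm (lambda - s) by exact: lt_le_trans far.
split; first by rewrite -subr_eq0 -rnorm_gt0.
have eg : 0 < eps + gamma by rewrite addr_gt0.
rewrite (delta_level_set g0 sl).
have d0 : 0 < eps / (gamma * (eps + gamma)) by rewrite divr_gt0 ?mulr_gt0.
apply: closure_nbhd => // e e0.
apply: contrapT => N.
have d1 : 0 < eps / (gamma * (eps + gamma)) + e by rewrite addr_gt0.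
have := resolvent_norm_numerical_range g0 sl far d1.
have h w : numerical_range dot (resolvent A s) w ->
    eps / (gamma * (eps + gamma)) + e <= rnorm ((lambda - s)^-1 - w).
  by move=> Ww; rewrite leNgt; apply/negP => lt; apply: N; exists w.
move=> /(_ h) /(le_trans lam); rewrite lee_fin.
have -> : gamma * (eps + gamma) * (eps / (gamma * (eps + gamma)) + e) =
    eps + gamma * (eps + gamma) * e.
  by field; rewrite !gt_eqF//; lra.
have := mulr_gt0 (mulr_gt0 g0 eg) e0.
by move=> p; rewrite lef_pV2 ?posrE ?addr_gt0//; lra.
Qed.

(* The point [lambda] itself is a shift in some level set as soon as
   [|R_lambda| < 1/eps], and [s] never lies in [U^-1 + s]. *)
Lemma resolvent_norm_ge lambda :
  (forall gamma s, 0 < gamma -> level_set A eps gamma s -> lambda != s) ->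
  ((eps^-1)%:E <= resolvent_norm A lambda)%E.
Proof.
move=> N; rewrite leNgt; apply/negP => lt.
have lA : resolvent_set A lambda.
  by move: lt; rewrite /resolvent_norm; case: asboolP => //; rewrite ltNge leey.
have r0 := resolvent_fine_gt0 lA H_neq0.
move: lt; rewrite resolvent_normE// (resolvent_fine lA) lte_fin => lt.
(* This [gamma] is positive and makes eps + gamma the inverse of |R_lambda|. *)
have := N ((fine (opnorm (resolvent A lambda)))^-1 - eps) lambda.
rewrite eqxx subr_gt0 -[ltLHS]invrK ltf_pV2 ?posrE ?invr_gt0// => /(_ lt).
suff h : level_set A eps ((fine (opnorm (resolvent A lambda)))^-1 - eps) lambda.
  by move=> /(_ h).
by split=> //; rewrite addrC subrK invrK -resolvent_fine.
Qed.

Lemma enclosure_resolvent_norm_ge lambda : enclosure A dot eps lambda ->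
  ((eps^-1)%:E <= resolvent_norm A lambda)%E.
Proof.
move=> lE; apply: resolvent_norm_ge => gamma s g0 sl.
by have /shift_inv_setP[] := lE gamma g0 s sl.
Qed.

Lemma closed_enclosure_resolvent_norm_ge lambda :
  closed_enclosure A dot eps lambda ->
  ((eps^-1)%:E <= resolvent_norm A lambda)%E.
Proof.
move=> lE; apply: resolvent_norm_ge => gamma s g0 sl.
by have /shift_inv_setP[] := lE gamma g0 s sl.
Qed.

End enclosures.

(** * Normal operators with compact resolvent *)

Section normal_resolvent.
Variables (R : realType) (H : completeNormedModType R[i]).
Variable dot : {dot H for Num.conj}.
Hypothesis dot_norm : forall x : H, dot x x = `|x| ^+ 2.
Variable A : linop H.
Hypothesis A_dense : densely_defined A.
Hypothesis A_normal : normal_op A dot.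
Variable s : R[i].
Hypothesis sA : resolvent_set A s.
Implicit Types (x y z w u v : H).

Local Notation Rs := (resolvent A s).
Let T : {linear H -> H} := mklin (resolvent_linear sA).
Let r := fine (opnorm Rs).

Let TM : bounded_by T r. Proof. exact: resolvent_bounded. Qed.

Let r_ge0 : 0 <= r. Proof. exact: resolvent_fine_ge0. Qed.

Let S : {linear H -> H} := mklin (adj_linear dot_norm TM).

Let SM : bounded_by S r. Proof. exact: (adj_bounded dot_norm TM). Qed.

Let TS : adjoint_pair dot T S.
Proof. by move=> x y; exact: (adjP dot_norm TM). Qed.

(** Density gives x in the domain with |w - x| < |w| if w is nonzero, but x orthogonal to w forces
    |w - x| >= |w|. *)
Lemma dense_dot_eq0 w : (forall x, dom A x -> dot x w = 0) -> w = 0.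
Proof.
move=> Aw; apply/eqP/negPn/negP; rewrite -rnorm_gt0 => w0.
have [||x [/ball_rnorm wx Ax]] := A_dense (O := ball w (rnorm w)%:C).
- by exists w; apply: ballxx; rewrite ltcR.
- by apply: ball_open; rewrite ltcR.
have : rnorm w ^+ 2 <= rnorm (w - x) ^+ 2.
  rewrite (sqr_rnormB dot_norm) Re_dotC Aw//= mulr0 subr0 lerDl.
  exact: sqr_ge0.
by rewrite leNgt ltr_pXn2r ?nnegrE ?rnorm_ge0// wx.
Qed.

(* [z = (1 + A* A)^-1 y] *)
Definition inv1AA y z := dom A z /\ adjoint_graph A dot (A z, y - z).

(** Put z = T w, and let B = A T = 1 + s T, which is bounded. Testing against x = T v turns the
    equation into T* T w + B* B w = T* y, whose left side is coercive because v = B v - s T v. *)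
Lemma inv1AA_exists y : exists z, inv1AA y z.
Proof.
have Bl : linear (fun w => w + s *: Rs w).
  move=> a v w; rewrite (resolvent_linear sA) !scalerDr !scalerA (mulrC s).
  by rewrite -!scalerA addrACA.
pose B := mklin Bl.
have BM : bounded_by B (1 + rnorm s * r).
  move=> x; rewrite mulrDl mul1r; apply: le_trans (ler_rnormD _ _) _.
  by rewrite lerD2l rnormZ -mulrA ler_wpM2l ?rnorm_ge0//; exact: TM.
have b0 : 0 <= 1 + rnorm s * r by rewrite addr_ge0// mulr_ge0 ?rnorm_ge0.
pose B' := mklin (adj_linear dot_norm BM).
have B'M : bounded_by B' (1 + rnorm s * r) by exact: (adj_bounded dot_norm BM).
have BB' : adjoint_pair dot B B' by move=> v w; exact: (adjP dot_norm BM).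
have [M ME] : exists M : {linear H -> H}, forall x, M x = S (T x) + B' (B x).
  suff Ml : linear (fun x => S (T x) + B' (B x)) by exists (mklin Ml).
  by move=> a v w; rewrite !linearP scalerDr addrACA.
have MM : bounded_by M (r * r + (1 + rnorm s * r) * (1 + rnorm s * r)).
  move=> x; rewrite ME mulrDl; apply: le_trans (ler_rnormD _ _) _.
  apply: lerD.
    by apply: le_trans (SM _) _; rewrite -mulrA ler_wpM2l.
  by apply: le_trans (B'M _) _; rewrite -mulrA ler_wpM2l.
have Mdot v w : dot v (M w) = dot (T v) (T w) + dot (B v) (B w).
  by rewrite ME dotDr -TS -BB'.
(* The constant comes from (p + q t)^2 <= 2 (1 + q^2) (p^2 + t^2) with p = |B x|, q = |s|, t = |T
   x|. *)
have d0 : 0 < (2 * (1 + rnorm s ^+ 2))^-1.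
  by rewrite invr_gt0 mulr_gt0// ltr_pwDl// sqr_ge0.
have Mc x : (2 * (1 + rnorm s ^+ 2))^-1 * rnorm x ^+ 2 <= rnorm (dot (M x) x).
  rewrite rnorm_dotC; apply: le_trans (ler_Re_rnorm _).
  rewrite Mdot raddfD /= !(Re_dotxx dot_norm).
  rewrite mulrC ler_pdivrMr; last by rewrite -invr_gt0.
  have h : rnorm x <= rnorm (B x) + rnorm s * rnorm (T x).
    rewrite -rnormZ; apply: le_trans (ler_rnormB _ _).
    by have -> : B x - s *: T x = x by exact: addrK.
  have h2 : rnorm x ^+ 2 <= (rnorm (B x) + rnorm s * rnorm (T x)) ^+ 2.
    by rewrite ler_pXn2r ?nnegrE ?addr_ge0 ?mulr_ge0 ?rnorm_ge0.
  apply: le_trans h2 _.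
  move: (rnorm (B x)) (rnorm s) (rnorm (T x)) => p q t.
  have := sqr_ge0 (p - q * t); have := sqr_ge0 (p * q); have := sqr_ge0 t.
  by nra.
have [w Mw] := coercive_surjective dot_norm d0 MM Mc (S y).
exists (T w); split; first exact: resolvent_dom.
move=> x Ax /=; rewrite !app_resolvent//.
have -> : A x = B (A x - s *: x) by rewrite /= resolventK// subrK.
have Tx : T (A x - s *: x) = x by exact: resolventK.
have := Mdot (A x - s *: x) w; rewrite Mw -TS Tx => E.
by rewrite dotBr E [RHS]addrC addKr.
Qed.

(** The difference h of two solutions satisfies |A h|^2 = - |h|^2. *)
Lemma inv1AA_unique y z z' : inv1AA y z -> inv1AA y z' -> z = z'.
Proof.
move=> [Az zP] [Az' z'P]; apply/eqP; rewrite -subr_eq0.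
have Ad := dom_sub Az Az'.
have : dot (A (z - z')) (A z - A z') = - dot (z - z') (z - z').
  rewrite dotBr zP// z'P//= -dotBr.
  have -> : y - z - (y - z') = - (z - z') by rewrite !opprB addrC addrA subrK.
  exact: dotNr.
have -> : A z - A z' = A (z - z').
  have := shift_sub 0 Az Az'; rewrite !scale0r !subr0 => <-.
  by [].
rewrite !(dotxx dot_norm) -!rmorphXn -rmorphN => /complexI E.
rewrite -rnorm_eq0 -sqrf_eq0 eq_le sqr_ge0 andbT.
by rewrite -oppr_ge0 -E sqr_ge0.
Qed.

(** Normality enters here: A* A z = y - z is traded for A A* z = y - z, with u = A* z. *)
Lemma inv1AA_normal y z : inv1AA y z <->
  exists u, adjoint_graph A dot (z, u) /\ dom A u /\ A u = y - z.
Proof.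
have E : [set p : H * H | exists y, graph A (p.1, y) /\ adjoint_graph A dot (y, p.2)] (z, y - z) <->
    [set p : H * H | exists y, adjoint_graph A dot (p.1, y) /\ graph A (y, p.2)] (z, y - z).
  by rewrite A_normal.
split=> [[Az zP]|[u [zu [Au uE]]]].
  have /E[u [zu [/= Au uE]]] : [set p : H * H |
      exists y, graph A (p.1, y) /\ adjoint_graph A dot (y, p.2)] (z, y - z).
    by exists (A z).
  by exists u.
have /E[v [[/= Az ->] vP]] : [set p : H * H |
    exists y, adjoint_graph A dot (p.1, y) /\ graph A (y, p.2)] (z, y - z).
  by exists u.
by [].
Qed.

(** Put t = A* z - conj(s) z. As S q = (A - s) z, the vector q is (A* - conj s) (A - s) z, which
    equals (A - s) t because A* A z = A A* z. Hence T q = t, and S t = z by duality. Unbounded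
    identities are tested against the dense domain. *)
Lemma resolvent_adj_factor y z q : inv1AA y z -> z = T (S q) -> z = S (T q).
Proof.
move=> yz; have [Az zP] := yz; have /inv1AA_normal[u [zu [Au uE]]] := yz.
move=> zq; pose t := u - Num.conj s *: z.
have At : dom A t by apply: dom_sub => //; exact: domZ.
have Sq : A z - s *: z = S q by rewrite zq; exact: (resolvent_eq sA).
have shiftA x : dom A x -> dot (A x - s *: x) z = dot x t.
  by move=> Ax; rewrite dotBl dotZl zu//= dotBr dotZr conjCK.
have qE : A t - s *: t = q.
  apply/eqP; rewrite -subr_eq0; apply/eqP/dense_dot_eq0 => x Ax.
  have -> : dot x (A t - s *: t - q) = dot x (A t - s *: t) - dot x q.
    by rewrite dotBr.
  have -> : dot x q = dot (A x - s *: x) (S q).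
    by rewrite -TS /= resolventK.
  rewrite -Sq [dot (A x - s *: x) (A z - _)]dotBr [dot _ (s *: z)]dotZr shiftA//.
  rewrite dotBl zP//= dotZl -uE.
  have -> : A t = A u - Num.conj s *: A z.
    have := shift_sub 0 Au (domZ (Num.conj s) Az).
    by rewrite !scale0r !subr0 appZ.
  by rewrite /t !dotBr !dotZr !dotBr !dotZr conjCK subrr.
apply: (dot_inj dot_norm) => v.
have Tv : A (T v) - s *: T v = v by exact: (resolvent_eq sA).
have Tq : T q = t by rewrite -qE; exact: resolventK.
by rewrite -TS Tq -shiftA ?Tv//; exact: resolvent_dom.
Qed.

(* [C = (1 + A* A)^-1 = (1 + A A* )^-1] commutes with [A], hence with [T] and
   [S], and [T S = S T] holds on its range by [resolvent_adj_factor]. *)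
Lemma resolvent_normal x : T (S x) = S (T x).
Proof.
have /choice[C CP] := inv1AA_exists.
have CE y z : inv1AA y z -> z = C y by move=> /inv1AA_unique; exact.
have Csym v w : dot (C v) w = dot v (C w).
  have [Av vP] := CP v; have [Aw wP] := CP w.
  have := wP _ Av; rewrite dotC vP// -dotC /= dotBl dotBr.
  by move=> /addIr.
(* A* A C y = y - C y lies in the domain of [A], so A (C y) solves the A A* form of the equation for
   A y. *)
have CA y : dom A y -> C (A y) = A (C y).
  move=> Ay; have [Ac cP] := CP y; apply/esym/CE/inv1AA_normal.
  exists (y - C y); split => //; split; first exact: dom_sub.
  by have := shift_sub 0 Ay Ac; rewrite !scale0r !subr0.
have CB v w : C (v - w) = C v - C w.
  by apply: (dot_inj dot_norm) => u; rewrite -Csym !dotBr !Csym.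
have CZ a v : C (a *: v) = a *: C v.
  by apply: (dot_inj dot_norm) => u; rewrite -Csym !dotZr !Csym.
have CT w : C (T w) = T (C w).
  have Aw : dom A (T w) by exact: resolvent_dom.
  have Ac : dom A (C (T w)) by case: (CP (T w)).
  rewrite -[LHS](resolventK sA Ac) -CA// -CZ -CB; congr (T (C _)).
  exact: (resolvent_eq sA).
have CS w : C (S w) = S (C w).
  by apply: (dot_inj dot_norm) => u; rewrite -Csym -!TS -CT Csym.
have C0 w : C w = 0 -> w = 0.
  move=> Cw; apply: dense_dot_eq0 => y Ay; have [_ /(_ y Ay)] := CP w.
  by rewrite Cw /= app0 subr0 dot0r.
(* [C] is injective, so the identity may be checked after applying it; C T S x = T S C x is then in
   the form required, with q = C x. *)
apply/eqP; rewrite -subr_eq0; apply/eqP/C0; rewrite CB.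
rewrite (@resolvent_adj_factor (T (S x)) (C (T (S x))) (C x)) //.
- by rewrite !CS !CT subrr.
- by rewrite CT CS.
Qed.

Hypothesis H_neq0 : exists x : H, x != 0.

(** R_s has an eigenvalue nu with |nu| = |R_s|; the corresponding eigenvalue of [A] is s + nu^-1. *)
Lemma resolvent_eigenvalue : seq_compact Rs -> exists lambda x,
  [/\ dom A x, x != 0, A x = lambda *: x & rnorm (lambda - s) * r = 1].
Proof.
move=> Tc.
have [nu [x [x0 Tx Tnu]]] :=
  normal_compact_eigenvector dot_norm TM SM TS resolvent_normal Tc H_neq0.
have r0 : 0 < r by exact: resolvent_fine_gt0.
have rnu : r = rnorm nu.
  apply/eqP; rewrite eq_le; apply/andP; split.
    by rewrite -lee_fin -resolvent_fine//; apply: (opnorm_le (T := T)) => //; exact: rnorm_ge0.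
  by rewrite -(@ler_pM2r _ (rnorm x)) ?rnorm_gt0// -rnormZ -Tx; exact: TM.
have nu0 : nu != 0 by rewrite -rnorm_gt0 -rnu.
have xE : x = nu^-1 *: T x by rewrite Tx scalerA mulVf// scale1r.
have Ax : dom A x by rewrite xE; apply: domZ; exact: resolvent_dom.
exists (s + nu^-1), x; split => //.
  have E : nu *: (A x - s *: x) = x.
    rewrite scalerBr -appZ// scalerA mulrC -scalerA -Tx.
    exact: (resolvent_eq sA).
  have -> : (s + nu^-1) *: x = s *: x + nu^-1 *: (nu *: (A x - s *: x)).
    by rewrite E scalerDl.
  by rewrite scalerA mulVf// scale1r addrC subrK.
by rewrite addrC addKr rnormV rnu mulVf// -rnu gt_eqF.
Qed.

End normal_resolvent.

(** * Eigenvalues of a normal operator with compact resolvent *)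

Section spectrum.
Variables (R : realType) (H : completeNormedModType R[i]).
Variable dot : {dot H for Num.conj}.
Hypothesis dot_norm : forall x : H, dot x x = `|x| ^+ 2.
Variable A : linop H.
Implicit Types (s lambda : R[i]) (x y : H).

(** First resolvent identity in the form R_s = (1 + (s - s0) R_s) R_s0, a bounded operator after a
    compact one. *)
Lemma resolvent_seq_compact s0 s : resolvent_set A s0 -> resolvent_set A s ->
  seq_compact (resolvent A s0) -> seq_compact (resolvent A s).
Proof.
move=> s0A sA s0c.
have Ll : linear (fun y => y + (s - s0) *: resolvent A s y).
  move=> a v w; rewrite (resolvent_linear sA) !scalerDr !scalerA (mulrC (s - s0)).
  by rewrite -!scalerA addrACA.
have -> : resolvent A s = mklin Ll \o resolvent A s0.
  apply/funext => y /=; set z := resolvent A s0 y.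
  have Az : dom A z by exact: resolvent_dom.
  have yE : y = (A z - s *: z) + (s - s0) *: z.
    by rewrite scalerBl addrA subrK; apply/esym; exact: resolvent_eq.
  rewrite {1}yE addrC (resolvent_linear sA) resolventK// addrC.
  by [].
apply: (seq_compact_comp (M := 1 + rnorm (s - s0) * fine (opnorm (resolvent A s)))).
  exact: s0c.
move=> x; rewrite mulrDl mul1r; apply: le_trans (ler_rnormD _ _) _.
by rewrite lerD2l rnormZ -mulrA ler_wpM2l ?rnorm_ge0//; exact: resolvent_bounded.
Qed.

Lemma eigenvector_resolvent s lambda x : resolvent_set A s ->
  dom A x -> A x = lambda *: x -> (lambda - s) *: resolvent A s x = x.
Proof.
move=> sA Ax xE.
have := resolventK sA Ax; rewrite xE -scalerBl => E.
have := resolvent_linear sA (lambda - s) x 0; rewrite addr0 E.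
have -> : resolvent A s 0 = 0.
  by have := resolventK sA (dom0 A); rewrite app0 scaler0 subrr.
by rewrite addr0.
Qed.

Lemma eigenvalue_far s lambda x : resolvent_set A s ->
  dom A x -> x != 0 -> A x = lambda *: x ->
  1 <= rnorm (lambda - s) * fine (opnorm (resolvent A s)).
Proof.
move=> sA Ax x0 xE; rewrite -(@ler_pM2r _ (rnorm x)) ?rnorm_gt0// mul1r.
rewrite -{1}(eigenvector_resolvent sA Ax xE) rnormZ -mulrA.
by rewrite ler_wpM2l ?rnorm_ge0//; exact: resolvent_bounded.
Qed.

Definition eigenvalues : set R[i] :=
  [set lambda | exists x, [/\ dom A x, x != 0 & A x = lambda *: x]].

Hypothesis A_dense : densely_defined A.
Hypothesis A_normal : normal_op A dot.

(* Unit eigenvectors [x_n] for distinct eigenvalues in a disc are orthogonal,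
   so that the [T x_n] are uniformly separated, against compactness. *)
Lemma finite_eigenvalues s (L : R) : resolvent_set A s ->
  seq_compact (resolvent A s) -> 0 < L ->
  finite_set (eigenvalues `&` [set lambda | rnorm lambda <= L]).
Proof.
move=> sA Tc L0; apply: contrapT => /infiniteP/(@pcard_leP _ R[i]^o)[g0].
have [g [gE ginj]] : exists g : nat -> R[i],
    (forall n, eigenvalues (g n) /\ rnorm (g n) <= L) /\ injective g.
  exists g0; split=> [n|m n gmn]; first by have [] := @funS _ _ _ _ g0 n I.
  by apply: (@inj _ _ _ g0) => //; exact: mem_set.
have /choice[x xP] n : exists x,
    [/\ dom A x, rnorm x = 1 & A x = g n *: x].
  have [[x [Ax x0 xE]] _] := gE n.
  exists ((rnorm x)^-1%:C *: x); split; first exact: domZ.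
    by rewrite rnormZ rnormC ger0_norm ?invr_ge0 ?rnorm_ge0// mulVf ?rnorm_eq0.
  by rewrite appZ// xE !scalerA mulrC.
pose r := fine (opnorm (resolvent A s)).
pose T : {linear H -> H} := mklin (resolvent_linear sA).
have TM : bounded_by T r by exact: resolvent_bounded.
pose S : {linear H -> H} := mklin (adj_linear dot_norm TM).
have TS : adjoint_pair dot T S by move=> y z; exact: (adjP dot_norm TM).
have TSC y : T (S y) = S (T y) by exact: resolvent_normal.
have x0 n : x n != 0.
  by have [_ x1 _] := xP n; rewrite -rnorm_gt0 x1.
have gs n : g n - s != 0.
  have [Ax _ xE] := xP n; apply: contra_neq (x0 n) => gs0.
  by rewrite -(eigenvector_resolvent sA Ax xE) gs0 scale0r.
have Tx n : T (x n) = (g n - s)^-1 *: x n.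
  have [Ax _ xE] := xP n.
  rewrite -{2}(eigenvector_resolvent sA Ax xE) scalerA mulVf// scale1r.
  by [].
have ort m n : m != n -> dot (x m) (x n) = 0.
  move=> mn; apply: (normal_eigenvectors_orthogonal dot_norm TS TSC _ (Tx m) (Tx n)).
  by apply: contra_neq mn => /invr_inj/addIr/ginj.
pose c := (L + rnorm s)^-1.
have Ls : 0 < L + rnorm s by rewrite ltr_pwDl// rnorm_ge0.
have c0 : 0 < c by rewrite invr_gt0.
have Tc0 n : c <= rnorm (T (x n)).
  have [_ x1 _] := xP n; have [_ gL] := gE n.
  rewrite Tx rnormZ x1 mulr1 rnormV lef_pV2 ?posrE ?rnorm_gt0//.
  by apply: le_trans (ler_rnormB _ _) _; rewrite lerD2r.
have [|f [fn [l Tl]]] := Tc x; first by move=> n; have [_ -> _] := xP n.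
have [N TN] := cvg_rcauchy Tl c0.
(* [f] need not be injective, but f (f N + 1) >= f N + 1 > f N, so these two indices select
   distinct, hence orthogonal, eigenvectors. *)
have := TN N (f N).+1 (leqnn _) (leq_trans (fn N) (leqnSn _)).
apply/negP; rewrite -leNgt.
set p := f N; set q := f _.+1.
have pq : p != q by rewrite neq_ltn (leq_trans (ltnSn _) (fn _)).
rewrite -(@ler_pXn2r _ 2) ?nnegrE ?rnorm_ge0 ?(ltW c0)// (sqr_rnormB dot_norm).
rewrite -![resolvent A s _]/(T _).
have -> : dot (T (x p)) (T (x q)) = 0.
  by rewrite !Tx dotZl dotZr ort// !mulr0.
rewrite mulr0 subr0; apply: (@le_trans _ _ (rnorm (T (x p)) ^+ 2)).
  by rewrite ler_pXn2r ?nnegrE ?rnorm_ge0 ?(ltW c0).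
by rewrite lerDl sqr_ge0.
Qed.

Lemma finite_set_separated (U : set R[i]) : finite_set U ->
  exists2 eta : R, 0 < eta &
    forall a b, U a -> U b -> a != b -> eta <= rnorm (a - b).
Proof.
move=> /finite_seqP[l ->].
have lower (q : seq R) : exists2 eta : R, 0 < eta &
    forall a, a \in q -> 0 < a -> eta <= a.
  elim: q => [|b q [eta eta0 qP]]; first by exists 1.
  have [b0|b0] := ltP 0 b.
    exists (Num.min b eta) => [|a]; first by rewrite lt_min b0.
    rewrite in_cons => /orP[/eqP ->|aq] a0; first by rewrite ge_min lexx.
    by rewrite ge_min qP// orbT.
  exists eta => // a; rewrite in_cons => /orP[/eqP ->|aq]; last exact: qP.
  by rewrite ltNge b0.
have [eta eta0 etaP] := lower [seq rnorm (a - b) | a <- l, b <- l].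
exists eta => // a b /= al bl ab; apply: etaP.
  by apply/allpairsP; exists (a, b).
by rewrite rnorm_gt0 subr_eq0.
Qed.

End spectrum.

(* With [nu] the eigenvalue of maximal modulus of [R_lambda], the nearest
   eigenvalue [lambda0 = lambda + nu^-1] of [A] lies at distance [eps]; moving
   away from it by [gamma = eps / 2] yields [s] for which it is still the nearest
   one, so that [s] is in the level set of [gamma] while [|lambda - s| = gamma]. *)
Lemma normal_enclosure (R : realType) (H : completeNormedModType R[i])
    (dot : {dot H for Num.conj})
    (dot_norm : forall x : H, dot x x = `|x| ^+ 2)
    (H_neq0 : exists x : H, x != 0)
    (A : linop H) (A_dense : densely_defined A) (A_normal : normal_op A dot)
    (A_compact : compact_resolvent A) (L : R) : 0 < L ->
  exists2 eps0 : R, 0 < eps0 & forall eps : R, 0 < eps < eps0 ->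
    forall lambda, rnorm lambda <= L -> enclosure A dot eps lambda ->
    pseudospectrum A eps lambda.
Proof.
move=> L0; have [s0 s0A /compact_op_seq s0c] := A_compact.
have L1 : 0 < L + 1 by rewrite addr_gt0.
have [eta eta0 etaP] := finite_set_separated
  (finite_eigenvalues dot_norm A_dense A_normal s0A s0c L1).
(* Below, two eigenvalues are located within L + 2 eps of 0 and within 3 eps of each other: eps <
   1/2 keeps them in the disc of radius L + 1, and eps < eta/3 makes them equal. *)
exists (Num.min (1 / 2) (eta / 3)); first by rewrite lt_min !divr_gt0.
move=> eps /andP[e0]; rewrite lt_min => /andP[e1 e2] lambda lamL lamE.
rewrite /pseudospectrum /=.
have := enclosure_resolvent_norm_ge H_neq0 e0 lamE; rewrite le_eqVlt => /orP[/eqP|//].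
move=> rE; exfalso.
have lA : resolvent_set A lambda.
  by move: rE; rewrite /resolvent_norm; case: asboolP.
rewrite resolvent_normE// in rE.
have rfE : fine (opnorm (resolvent A lambda)) = eps^-1 by rewrite -rE.
have [lambda0 [x [Ax x0 xE]]] := resolvent_eigenvalue dot_norm A_dense A_normal lA
  H_neq0 (resolvent_seq_compact s0A lA s0c).
rewrite rfE => /(canRL (mulfK _)) lam0.
have {}lam0 : rnorm (lambda0 - lambda) = eps.
  by rewrite lam0 ?invr_eq0 ?gt_eqF// mul1r invrK.
pose s := lambda - 2^-1%:C * (lambda0 - lambda).
have sl : rnorm (lambda - s) = eps / 2.
  rewrite /s subKr rnormM lam0 rnormC ger0_norm ?invr_ge0//.
  by rewrite mulrC.
have sl0 : rnorm (lambda0 - s) = 3 * eps / 2.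
  have -> : lambda0 - s = (3 / 2)%:C * (lambda0 - lambda).
    have -> : (3 / 2 : R) = 1 + 2^-1 by field.
    by rewrite rmorphD rmorph1 mulrDl mul1r /s opprB addrA [RHS]addrAC.
  rewrite rnormM lam0 rnormC ger0_norm ?divr_ge0//.
  by rewrite mulrAC.
have ls0 : lambda - s != 0 by rewrite -rnorm_gt0 sl divr_gt0.
have sA : resolvent_set A s.
  have [|+ _] := resolvent_set_near lA dot_norm (mu := (s - lambda)^-1).
    rewrite rfE rnormV rnorm_distC sl ltf_pV2 ?posrE ?divr_gt0//.
    by rewrite ltr_pdivrMr// ltr_pMr// ltr1n.
  by rewrite invrK addrC subrK.
(* [lambda1] attains the distance 1/|R_s| from [s] to the eigenvalues, so it is no farther from [s]
   than [lambda0]. *)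
have [lambda1 [x1 [Ax1 x10 xE1]]] := resolvent_eigenvalue dot_norm A_dense A_normal sA
  H_neq0 (resolvent_seq_compact s0A sA s0c).
have far := eigenvalue_far sA Ax x0 xE.
set r := fine (opnorm (resolvent A s)) in far * => lam1.
have r0 : 0 < r by exact: resolvent_fine_gt0.
have lam1s : rnorm (lambda1 - s) <= 3 * eps / 2.
  by rewrite -(ler_pM2r r0) lam1 -sl0.
have lam0L : rnorm lambda0 <= L + 1.
  have -> : lambda0 = lambda + (lambda0 - lambda) by rewrite addrC subrK.
  by apply: le_trans (ler_rnormD _ _) _; rewrite lam0; lra.
have lam1L : rnorm lambda1 <= L + 1.
  have -> : lambda1 = lambda + ((lambda1 - s) - (lambda - s)).
    by ring.
  apply: le_trans (ler_rnormD _ _) _; have := ler_rnormB (lambda1 - s) (lambda - s).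
  by rewrite sl; lra.
have lam01 : lambda1 = lambda0.
  apply/eqP/negPn/negP => ne.
  have : eta <= rnorm (lambda1 - lambda0).
    by apply: etaP => //; split=> //; [exists x1|exists x].
  have -> : lambda1 - lambda0 = (lambda1 - s) - (lambda0 - s).
    by ring.
  have := ler_rnormB (lambda1 - s) (lambda0 - s).
  by rewrite sl0; lra.
have rs : r = (eps + eps / 2)^-1.
  move: lam1; rewrite lam01 sl0 => /(canRL (mulKf _)) ->; last first.
    by rewrite gt_eqF// divr_gt0// mulr_gt0.
  by rewrite mulr1; congr (_^-1); field.
have g0 : 0 < eps / 2 by rewrite divr_gt0.
have sL : level_set A eps (eps / 2) s.
  by split => //; rewrite (resolvent_fine sA) -rs.
(* Here |(lambda - s)^-1| = 1/gamma and numerical values have modulus at most 1/(eps + gamma), so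
   their distance is at least delta_s, against the strict inequality of the open neighbourhood. *)
have /shift_inv_setP[_ /nbhdP[w [y y1 <-]]] := lamE (eps / 2) g0 s sL.
apply/negP; rewrite -leNgt; apply: le_trans (lerB_rnorm _ _).
have := rnorm_dot_resolvent sA dot_norm y1; rewrite -/r rs.
rewrite (delta_level_set e0 g0 sL) rnormV sl => h.
apply: (@le_trans _ _ ((eps / 2)^-1 - (eps + eps / 2)^-1)); last by rewrite lerB.
rewrite le_eqVlt; apply/orP; left; apply/eqP; field.
by rewrite !gt_eqF//; lra.
Qed.

Theorem theorem2p5 (R : realType) (H : completeNormedModType R[i])
    (dot : {dot H for Num.conj})
    (dot_norm : forall x : H, dot x x = `|x| ^+ 2)
    (H_neq0 : exists x : H, x != 0)
    (A : linop H) (A_closed : closed_op A) (A_dense : densely_defined A) :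
  (forall eps : R, 0 < eps ->
     pseudospectrum A eps `<=` enclosure A dot eps /\
     enclosure A dot eps `<=`
       [set lambda | ((eps^-1)%:E <= resolvent_norm A lambda)%E]) /\
  (forall eps : R, 0 < eps ->
     [set lambda | ((eps^-1)%:E <= resolvent_norm A lambda)%E] =
     closed_enclosure A dot eps) /\
  (normal_op A dot -> compact_resolvent A -> forall L : R, 0 < L ->
     exists2 eps0 : R, 0 < eps0 & forall eps : R, 0 < eps < eps0 ->
       pseudospectrum A eps `&` closure_set (disc L) =
       enclosure A dot eps `&` closure_set (disc L)).
Proof.
split; [|split].
- move=> eps eps0; split; first exact: pseudospectrum_sub_enclosure.
  by move=> lambda; exact: enclosure_resolvent_norm_ge.
- move=> eps eps0; apply/seteqP; split => lambda.
    exact: resolvent_norm_ge_sub_closed_enclosure.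
  exact: closed_enclosure_resolvent_norm_ge.
- move=> A_normal A_compact L L0.
  have [eps0 eps00 epsP] :=
    normal_enclosure dot_norm H_neq0 A_dense A_normal A_compact L0.
  exists eps0 => // eps eps1; apply/seteqP; split => lambda [lamE lamL]; split => //.
    by apply: pseudospectrum_sub_enclosure lamE; [exact: dot_norm|case/andP: eps1].
  by apply: epsP => //; exact: closure_disc_le.
Qed.
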